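(* Let $R=\Delta((0,0)^{\mathsf T},(0,1)^{\mathsf T},(1,0)^{\mathsf T})\subset\mathbb{R}^2$ and let $\alpha\in(0,2\pi)$ be an angle for which $\tan(\alpha)$ is a quadratic irrational number. Then there is a constant $C<\infty$ (depending only on $\alpha$) such that the following holds for every integer $N>1$. Let $\mathcal{P}_1$ be the set of points of the lattice $(2N)^{-1/2}\mathbb{Z}^2$ rotated anticlockwise about the origin by the angle $\alpha$, and let $\mathcal{P}_2$ be the set of points of $\mathcal{P}_1$ that lie in $R$. If $\mathcal{P}_2$ has at least $N$ points, let $\mathcal{P}_3$ be any $N$ points from $\mathcal{P}_2$; if $\mathcal{P}_2$ has fewer than $N$ points, let $\mathcal{P}_3$ be any list of $N$ points in $R$ including all those of $\mathcal{P}_2$. Then $$D_N^{\mathrm{P}}(\mathcal{P}_3;R)<\frac{C\log(N)}{N}.$$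
   Context: A quadratic irrational number is a real number of the form $(a+b\sqrt c)/d$ with $a,b,c,d$ integers, $b\ne0$, $d\ne0$, $c>0$ and $c$ not a perfect square. For non-collinear points $A,B,C$, $\Delta(A,B,C)=\{\omega_1A+\omega_2B+\omega_3C : \omega_j\ge 0,\ \omega_1+\omega_2+\omega_3=1\}$ is the closed triangle they span; $\mathbf{vol}$ is two-dimensional Lebesgue measure. Parallelogram discrepancy. Let $\Omega=\Delta(A,B,C)$. For $a,b\in(0,1]$ let $\mathcal{T}_{a,b,C}=\{C+s(A-C)+t(B-C): 0\le s\le a,\ 0\le t\le b\}$ be the parallelogram with vertex $C$ and side vectors $a(A-C)$, $b(B-C)$. Let $\mathcal{S}_C=\{\mathcal{T}_{a,b,C}: 0<a\le 1,\ 0<b\le 1\}$, define $\mathcal{S}_A,\mathcal{S}_B$ analogously (vertex $A$, resp. $B$, with side vectors along the two triangle sides leaving that vertex), and $\mathcal{S}_{\mathrm{P}}=\mathcal{S}_A\cup\mathcal{S}_B\cup\mathcal{S}_C$. For a list $\mathcal{P}=(\boldsymbol{x}_1,\dots,\boldsymbol{x}_N)$ of points of $\Omega$ and a measurable set $S$, put $\delta_N(S;\mathcal{P},\Omega)=\mathbf{vol}(S\cap\Omega)/\mathbf{vol}(\Omega)-\frac1N\sum_{i=1}^N 1_{\boldsymbol{x}_i\in S}$. Then $D_N^{\mathrm{P}}(\mathcal{P};\Omega)=\sup_{S\in\mathcal{S}_{\mathrm{P}}}|\delta_N(S;\mathcal{P},\Omega)|$. *)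

(* Defs.v *)
From HB Require Import structures.
From mathcomp Require Import all_boot all_order all_algebra.
From mathcomp Require Import all_classical all_reals all_analysis.
Set Implicit Arguments.
Unset Strict Implicit.
Unset Printing Implicit Defensive.
Import Order.TTheory GRing.Theory Num.Theory.
Import numFieldNormedType.Exports.
Local Open Scope classical_set_scope.
Local Open Scope ring_scope.

(* No such number is rational; in particular 0, the junk value of [tan] where
   [cos] vanishes, is excluded. *)
Definition quadratic_irrational (R : realType) (x : R) : Prop :=
  exists a b c d : int,
    [/\ b != 0, d != 0, 0 < c, ~ (exists m : int, c = m ^+ 2)
      & x = (a%:~R + b%:~R * Num.sqrt c%:~R) / d%:~R].

Definition vol (R : realType) (S : set (R * R)) : \bar R :=
  (@lebesgue_measure R \x @lebesgue_measure R)%E S.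

Definition triangle (R : realType) (A B C : R * R) : set (R * R) :=
  [set p | exists w1 w2 w3 : R,
    [/\ 0 <= w1, 0 <= w2, 0 <= w3, w1 + w2 + w3 = 1
      & p = w1 *: A + w2 *: B + w3 *: C]].

Definition parallelogram (R : realType) (V U W : R * R) (a b : R) :
    set (R * R) :=
  [set p | exists s t : R,
    [/\ 0 <= s <= a, 0 <= t <= b & p = V + s *: (U - V) + t *: (W - V)]].

Definition vertex_parallelograms (R : realType) (V U W : R * R) :
    set (set (R * R)) :=
  [set S | exists a b : R,
    [/\ 0 < a <= 1, 0 < b <= 1 & S = parallelogram V U W a b]].

Definition parallelograms (R : realType) (A B C : R * R) :
    set (set (R * R)) :=
  vertex_parallelograms A B C `|` vertex_parallelograms B C A
    `|` vertex_parallelograms C A B.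

Definition local_discrepancy (R : realType) (N : nat) (P : N.-tuple (R * R))
    (Omega S : set (R * R)) : R :=
  fine (vol (S `&` Omega)) / fine (vol Omega)
    - N%:R^-1 * \sum_(x <- P) \1_S x.

Definition parallelogram_discrepancy (R : realType) (A B C : R * R) (N : nat)
    (P : N.-tuple (R * R)) : \bar R :=
  ereal_sup [set `|local_discrepancy P (triangle A B C) S|%:E
            | S in parallelograms A B C].

Definition rotation (R : realType) (alpha : R) (p : R * R) : R * R :=
  (cos alpha * p.1 - sin alpha * p.2, sin alpha * p.1 + cos alpha * p.2).

Definition scaled_lattice (R : realType) (N : nat) : set (R * R) :=
  [set p | exists m n : int,
    p = (Num.sqrt (2 * N%:R))^-1 *: ((m%:~R, n%:~R) : R * R)].

Definition right_triangle (R : realType) : set (R * R) :=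
  triangle (0, 0) (0, 1) (1, 0).

Arguments scaled_lattice : clear implicits.
Arguments right_triangle : clear implicits.

Definition rotated_lattice_points (R : realType) (alpha : R) (N : nat) :
    set (R * R) :=
  (rotation alpha @` scaled_lattice R N) `&` right_triangle R.

(* In the first case the [N] points are distinct; in the second, the added
   points are arbitrary and repetitions are allowed. *)
Definition admissible_points (R : realType) (alpha : R) (N : nat)
    (P : N.-tuple (R * R)) : Prop :=
  let P2 := rotated_lattice_points alpha N in
  ((`I_N #<= P2)%card -> uniq P /\ [set` P] `<=` P2) /\
  (~ (`I_N #<= P2)%card ->
    [set` P] `<=` right_triangle R /\ P2 `<=` [set` P]).

(* Main.v *)
(* In barycentric coordinates every set to be tested is the triangle with at
   most two corners cut off, so by inclusion-exclusion it suffices to count the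
   lattice points of half-open triangles homothetic to it.  In the coordinates
   of the lattice the three edge directions have slopes that are integer Moebius
   images of [tan alpha], hence badly approximable.  Counting column by column,
   the number of lattice points differs from the area by the error of the
   trapezoidal rule, which is bounded because its first-order terms cancel at
   the vertices, and by sums of [floor (x i + y) + 1/2 - (x i + y)] over
   intervals of [i].  If [p / q] is a reduced fraction with
   [|q x - p| <= 1 / q], such a sum over [q] consecutive terms is bounded, as
   [p i] runs over all residues modulo [q]; for badly approximable [x],
   Dirichlet's theorem provides such a [q] comparable to any given length, so
   [O(log n)] blocks cover an interval of length [n]. *)
Require Import Defs.
From HB Require Import structures.
From mathcomp Require Import all_boot all_order all_algebra finmap.
From mathcomp Require Import all_classical all_reals all_analysis.
From mathcomp Require Import ring lra zify.
Import Order.TTheory GRing.Theory Num.Theory.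
Import numFieldNormedType.Exports.
Local Open Scope classical_set_scope.
Local Open Scope ring_scope.

Set Implicit Arguments.
Unset Strict Implicit.

(** * Badly approximable numbers *)

(** The height [|p| + |q|] in place of the usual [|q|] makes the condition homogeneous in the pair,
    so that integer linear substitutions only change the constant. For [q = 0] it just says
    [c <= 1]. *)
Definition badly_approximable (R : realType) (x : R) : Prop :=
  exists2 c : R, 0 < c & forall p q : int, (p != 0) || (q != 0) ->
    c <= `|q%:~R * x - p%:~R| * (`|p| + `|q|)%:~R.

Lemma sqr_eq_mul_sqr (c x y : int) :
  y != 0 -> x ^+ 2 = c * y ^+ 2 -> exists m : int, c = m ^+ 2.
Proof.
move=> y0 e; have : (y ^+ 2 %| x ^+ 2)%Z by rewrite e dvdz_mull.
rewrite dvdz_pexp2r// => /dvdzP[m xE]; exists m; move: e.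
by rewrite xE exprMn => /mulIf -> //; rewrite expf_eq0.
Qed.

(* The norm [(q a - p d)^2 - c (q b)^2] is a nonzero integer, so the two
   conjugates of [d (q x - p)] have product at least 1 in absolute value. *)
Lemma quadratic_irrational_badly_approximable (R : realType) (x : R) :
  quadratic_irrational x -> badly_approximable x.
Proof.
move=> [a [b [c [d [b0 d0 c0 nsq xE]]]]].
have dR : d%:~R != 0 :> R by rewrite intr_eq0.
set s : R := Num.sqrt c%:~R in xE.
have s2 : s ^+ 2 = c%:~R by rewrite sqr_sqrtr// ler0z ltW.
have s0 : 0 <= s by rewrite sqrtr_ge0.
(* The second factor bounds the conjugate [u - v s] relative to the height of [(p, q)]; the first
   one clears the denominator of [q x - p = (u + v s) / d]. *)
pose K : R := `|d%:~R| * (`|a%:~R| + `|d%:~R| + `|b%:~R| * s).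
have d1 : 0 < `|d%:~R| :> R by rewrite normr_gt0.
have K0 : 0 < K.
  have Bs0 : 0 <= `|b%:~R| * s by rewrite mulr_ge0.
  by rewrite mulr_gt0//; have := normr_ge0 (a%:~R : R); lra.
exists K^-1; first by rewrite invr_gt0.
move=> p q pq0.
set u : int := q * a - p * d; set v : int := q * b.
have nz : u ^+ 2 - c * v ^+ 2 != 0.
  apply/negP => /eqP/subr0_eq e; have [v0|v0] := eqVneq v 0; last first.
    exact: nsq (sqr_eq_mul_sqr v0 e).
  have q0 : q = 0 by move/eqP: v0; rewrite mulf_eq0 (negPf b0) orbF => /eqP.
  move/eqP: e; rewrite v0 expr0n/= mulr0 expf_eq0/= /u q0 mul0r sub0r oppr_eq0.
  by rewrite mulf_eq0 (negPf d0) orbF => /eqP p0; rewrite p0 q0 in pq0.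
have n1 : 1 <= `|u%:~R - v%:~R * s| * `|u%:~R + v%:~R * s| :> R.
  rewrite -normrM -subr_sqr exprMn s2.
  have -> (w z : int) : w%:~R ^+ 2 - z%:~R ^+ 2 * c%:~R = (w ^+ 2 - c * z ^+
    2)%:~R :> R.
    by rewrite !expr2 intrB !intrM [c%:~R * _]mulrC.
  by rewrite -intr_norm (ler_int _ 1) -gtz0_ge1 normr_gt0.
have -> : q%:~R * x - p%:~R = (u%:~R + v%:~R * s) / d%:~R.
  by rewrite xE /u /v !rmorphB/= !rmorphM/=; field.
have le2 : `|u%:~R - v%:~R * s| <=
    (`|a%:~R| + `|d%:~R| + `|b%:~R| * s) * (`|p| + `|q|)%:~R :> R.
  rewrite /u /v !rmorphB/= !rmorphM/= rmorphD/= !intr_norm.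
  apply: le_trans (ler_normB _ _) _; rewrite normrM.
  apply: le_trans (lerD (ler_normB _ _) (lexx _)) _.
  rewrite !normrM (ger0_norm s0).
  have := normr_ge0 (p%:~R : R); have := normr_ge0 (q%:~R : R).
  have := normr_ge0 (a%:~R : R); have := normr_ge0 (b%:~R : R).
  move: d1; move: `|_| `|_| `|_| `|_| `|_| => D B A Q P /ltW D0 B0 A0 Q0 P0.
  by have := mulr_ge0 D0 Q0; have := mulr_ge0 A0 P0;
     have := mulr_ge0 P0 (mulr_ge0 B0 s0); lra.
rewrite normf_div mulrAC ler_pdivlMr// /K invfM mulrAC mulVf ?gt_eqF// mul1r.
rewrite -[leLHS]mulr1 ler_pdivrMl; last first.
  by rewrite -(pmulr_rgt0 _ d1).
apply: le_trans n1 _.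
by rewrite [leRHS]mulrCA [leLHS]mulrC ler_wpM2l.
Qed.

(** The linear form at the image of [x] is, up to the factor [c x + d], the form at [x] for the pair
    obtained from [(p, q)] by the adjugate matrix. That pair is nonzero as the determinant is, and
    its height grows at most by the factor [|a| + |b| + |c| + |d|]. *)
Lemma badly_approximable_moebius (R : realType) (x : R) (a b c d : int) :
    a * d - b * c != 0 -> badly_approximable x ->
  badly_approximable ((a%:~R * x + b%:~R) / (c%:~R * x + d%:~R)).
Proof.
move=> det [k k0 kP].
have cd0 : (c != 0) || (d != 0).
  by apply: contraNT det; rewrite negb_or !negbK => /andP[/eqP-> /eqP->];
    rewrite !mulr0 subr0.
have D0 : c%:~R * x + d%:~R != 0.
  have := kP (- d) c; rewrite oppr_eq0 orbC => /(_ cd0).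
  rewrite mulrNz opprK; apply: contraTN => /eqP ->.
  by rewrite normr0 mul0r -ltNge.
set D := c%:~R * x + d%:~R in D0 *.
pose K : int := `|a| + `|b| + `|c| + `|d|.
have K0 : 0 < K by rewrite /K; lia.
have D1 : 0 < `|D| by rewrite normr_gt0.
have K0R : 0 < K%:~R :> R by rewrite ltr0z.
exists (k / K%:~R / `|D|); first by rewrite !divr_gt0.
move=> p q pq0.
have pq'0 : (p * d - q * b != 0) || (q * a - p * c != 0).
  have e1 : a * (p * d - q * b) + b * (q * a - p * c) = (a * d - b * c) * p by
    ring.
  have e2 : c * (p * d - q * b) + d * (q * a - p * c) = (a * d - b * c) * q by
    ring.
  move: pq0; apply: contraTT; rewrite !negb_or !negbK => /andP[/eqP u0 /eqP v0].
  move: e1 e2; rewrite u0 v0 !mulr0 !addr0 => /esym/eqP + /esym/eqP.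
  by rewrite !mulf_eq0 (negPf det)/= => -> ->.
have -> : q%:~R * ((a%:~R * x + b%:~R) / D) - p%:~R =
    ((q * a - p * c)%:~R * x - (p * d - q * b)%:~R) / D.
  by rewrite !rmorphB/= !rmorphM/= /D; field.
rewrite normf_div [leRHS]mulrAC ler_pM2r ?invr_gt0// ler_pdivrMr// -mulrA.
apply: le_trans (kP _ _ pq'0) _; apply: ler_wpM2l => //.
rewrite -intrM ler_int /K.
apply: le_trans (lerD (ler_normB _ _) (ler_normB _ _)) _; rewrite !normrM.
have := mulr_ge0 (normr_ge0 p) (normr_ge0 a);
  have := mulr_ge0 (normr_ge0 p) (normr_ge0 b).
have := mulr_ge0 (normr_ge0 q) (normr_ge0 c);
  have := mulr_ge0 (normr_ge0 q) (normr_ge0 d).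
by lra.
Qed.

Lemma badly_approximableN (R : realType) (x : R) :
  badly_approximable x -> badly_approximable (- x).
Proof.
move=> /(@badly_approximable_moebius _ _ (-1) 0 0 1 isT).
by rewrite mulrN1z mul0r add0r addr0 mulN1r divr1.
Qed.

(** * Sums of fractional parts *)

(** Pigeonhole: among the [k + 1] fractional parts of [0, x, ..., k x], two fall into the same of
    [k] bins of length [1 / k]. *)
Lemma dirichlet_approximation (R : realType) (x : R) (k : nat) : (0 < k)%N ->
  exists q : nat, exists p : int,
    [/\ (0 < q <= k)%N, coprimez p q & `|q%:R * x - p%:~R| * k%:R <= 1].
Proof.
move=> k0; have k0R : 0 < k%:R :> R by rewrite ltr0n.
pose fr (i : nat) : R := i%:R * x - (Num.floor (i%:R * x))%:~R.
have fr0 i : 0 <= fr i by rewrite subr_ge0 floor_le.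
have fr1 i : fr i < 1.
  by rewrite /fr ltrBlDr -[1]/(1%:~R) addrC -intrD floorD1_gt.
have [f fK] : exists f : 'I_k.+1 -> 'I_k,
    forall i, (f i)%:R <= fr i * k%:R < (f i).+1%:R.
  have H (i : 'I_k.+1) : exists j : 'I_k, j%:R <= fr i * k%:R < j.+1%:R.
    have y0 : 0 <= fr i * k%:R by rewrite mulr_ge0.
    have /andP[t1 t2] := truncn_itv y0.
    have tk : (Num.truncn (fr i * k%:R) < k)%N.
      by rewrite -(ltr_nat R); apply: le_lt_trans t1 _; rewrite gtr_pMl.
    by exists (Ordinal tk); rewrite t1.
  by have [f fP] := choice H; exists f.
have [inj|] := pselect (injective f).
  by have := leq_card f inj; rewrite !card_ord ltnn.
move=> ninj; have [i [j [ij fij]]] : exists i j : 'I_k.+1, (i < j)%N /\ f i = f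
  j.
  apply: contrapT => H; apply: ninj => i j fij; apply/val_inj => /=.
  by case: (ltngtP i j) => // lij; exfalso; apply: H; [exists i, j|exists j, i].
set q := (j - i)%N; set p := Num.floor (j%:R * x) - Num.floor (i%:R * x).
have q0 : (0 < q)%N by rewrite subn_gt0.
have qk : (q <= k)%N by rewrite /q; have := ltn_ord j; lia.
have pq : `|q%:R * x - p%:~R| * k%:R <= 1.
  rewrite -[X in _ * X](ger0_norm (ltW k0R)) -normrM.
  have -> : (q%:R * x - p%:~R) * k%:R = fr j * k%:R - fr i * k%:R.
    by rewrite /q natrB 1?ltnW// /p rmorphB/= /fr; ring.
  have := fK i; have := fK j; rewrite fij -!natr1 => /andP[? ?] /andP[? ?].
  by rewrite ler_norml; apply/andP; split; lra.
(* Dividing [p] and [q] by their gcd divides the error as well, so coprimality costs nothing. *)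
have g0 : (0 < gcdn `|p| q)%N by rewrite gcdn_gt0 q0 orbT.
set g := gcdn `|p| q in g0.
have gq : (g %| q)%N by rewrite dvdn_gcdr.
have gp : (g %| p)%Z by rewrite dvdzE; exact: dvdn_gcdl.
exists (q %/ g)%N, (p %/ g)%Z; split.
- by rewrite divn_gt0// dvdn_leq//= (leq_trans (leq_div _ _)).
- have : (g * gcdn `|(p %/ g)%Z| (q %/ g))%N = g.
    rewrite muln_gcdr -[X in (X * _)%N]/(`|g%:Z|%N) -abszM [_ * (_ %/
      _)%Z]mulrC.
    by rewrite divzK// mulnC divnK.
  by move/eqP; rewrite -[X in _ == X]muln1 eqn_pmul2l.
- apply: le_trans pq; apply: ler_wpM2r => //.
  have -> : q%:R * x - p%:~R = g%:R * ((q %/ g)%N%:R * x - (p %/ g)%Z%:~R).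
    rewrite mulrBr mulrA -natrM mulnC divnK//; congr (_ - _).
    by rewrite -[g%:R]/(g%:Z%:~R) -intrM mulrC divzK.
  by rewrite normrM ger0_norm// ler_peMl// ler1n.
Qed.

Lemma sum_ord (R : realType) (n : nat) :
  \sum_(i < n) (i%:R : R) = n%:R * (n%:R - 1) / 2.
Proof.
elim: n => [|n IH]; first by rewrite big_ord0 mul0r mul0r.
by rewrite big_ord_recr/= IH -natr1; field.
Qed.

(* As [p] is coprime to [q], the residues of [p i + k] are a permutation of
   those of [i]. *)
Lemma sum_divz_coprime (R : realType) (p k : int) (q : nat) :
    (0 < q)%N -> coprimez p q ->
  \sum_(i < q) ((p * i%:Z + k) %/ q)%Z%:~R =
    (p%:~R - 1) * (q%:R - 1) / 2 + k%:~R :> R.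
Proof.
case: q => // q _ pq; set Q := q.+1.
have modlt i : (`|(p * i%:Z + k) %% Q|%Z < Q)%N.
  by have := @ltz_mod (p * i%:Z + k) Q isT;
    have := @modz_ge0 (p * i%:Z + k) Q isT; lia.
pose h (i : 'I_Q) : 'I_Q := Ordinal (modlt i).
have hI : injective h.
  move=> i j [] e; have {}e : (p * i%:Z + k = p * j%:Z + k %[mod Q])%Z.
    by have := @modz_ge0 (p * i%:Z + k) Q isT;
      have := @modz_ge0 (p * j%:Z + k) Q isT; lia.
  move/eqP: e; rewrite eqz_mod_dvd opprD addrACA subrr addr0 -mulrBr.
  rewrite Gauss_dvdzr; last by rewrite coprimez_sym.
  rewrite -eqz_mod_dvd => /eqP.
  rewrite !modz_small//; first by move=> [] /val_inj.
  - by rewrite /= ltz_nat ltn_ord.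
  - by rewrite /= ltz_nat ltn_ord.
have Q0 : Q%:R != 0 :> R by rewrite pnatr_eq0.
apply: (mulfI Q0); rewrite mulr_sumr.
under eq_bigr => i _.
  have -> : Q%:R * ((p * i%:Z + k) %/ Q)%Z%:~R =
      p%:~R * i%:R + k%:~R - (h i)%:R :> R.
    rewrite [X in _ - X]/= natr_absz ger0_norm ?modz_ge0//.
    rewrite -[Q%:R]/(Q%:Z%:~R) -[i%:R]/(i%:Z%:~R) -!intrM -intrD -intrB.
    congr (_%:~R); apply/eqP; rewrite eq_sym subr_eq [Q%:Z * _]mulrC; apply/eqP.
    exact: divz_eq.
  over.
rewrite big_split/= big_split/= -mulr_sumr sumr_const card_ord sumrN.
have -> : \sum_(i < Q) (h i)%:R = \sum_(i < Q) i%:R :> R by rewrite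
  [RHS](reindex_inj hI).
rewrite !sum_ord -mulr_natl.
by field.
Qed.

(** On a block of length [q], replacing [x] by [p / q] moves [q (x i + y)] by at most 1, so the
    floors are squeezed between integer quotients whose sums are known exactly. *)
Lemma sum_floor_block (R : realType) (x y : R) (q : nat) (p : int) :
    (0 < q)%N -> coprimez p q -> `|q%:R * x - p%:~R| * q%:R <= 1 ->
  `|\sum_(i < q) ((Num.floor (x * i%:R + y))%:~R + 2^-1 - (x * i%:R + y))| <= 3.
Proof.
move=> q0 cpq; have q0R : 0 < q%:R :> R by rewrite ltr0n.
have q0Z : 0 < q%:Z by [].
set e := q%:R * x - p%:~R => eq1.
have xE : x = (p%:~R + e) / q%:R by rewrite /e; field; rewrite gt_eqF.
pose k := Num.floor (q%:R * y).
have kl : k%:~R <= q%:R * y := floor_le _.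
have kr : q%:R * y < k%:~R + 1 by rewrite -[1]/(1%:~R) -intrD floorD1_gt.
have ei (i : 'I_q) : `|i%:R * e| <= 1.
  rewrite normrM ger0_norm// mulrC; apply: le_trans eq1.
  by rewrite ler_wpM2l// ler_nat ltnW.
have yE (i : 'I_q) : (x * i%:R + y) * q%:R = p%:~R * i%:R + q%:R * y + i%:R * e.
  by rewrite xE; field; rewrite gt_eqF.
(* The offsets [k - 1] here and [k + 2] in [hi] come from [k <= q y < k + 1] and [|i e| <= 1]. *)
have lo (i : 'I_q) : ((p * i%:Z + (k - 1)) %/ q)%Z <= Num.floor (x * i%:R + y).
  rewrite floor_ge_int -(ler_pM2r q0R) yE.
  have : (((p * i%:Z + (k - 1)) %/ q)%Z * q%:Z)%:~R <= (p * i%:Z + (k - 1))%:~R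
    :> R.
    by rewrite ler_int lez_floor// gt_eqF.
  rewrite rmorphM rmorphD rmorphM rmorphB/= => H; apply: le_trans H _.
  by have := ei i; rewrite ler_norml => /andP[? ?]; rewrite -[i%:~R]/(i%:R);
    lra.
have hi (i : 'I_q) : Num.floor (x * i%:R + y) <= ((p * i%:Z + (k + 2)) %/ q)%Z.
  rewrite lez_divRL//.
  have : (Num.floor (x * i%:R + y) * q%:Z)%:~R < (p * i%:Z + (k + 2))%:~R :> R.
    rewrite rmorphM rmorphD rmorphM rmorphD/=.
    have : (Num.floor (x * i%:R + y))%:~R * q%:R <= (x * i%:R + y) * q%:R.
      by rewrite ler_pM2r// floor_le.
    rewrite yE => H; apply: le_lt_trans H _.
    by have := ei i; rewrite ler_norml => /andP[? ?]; rewrite -[i%:~R]/(i%:R);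
      lra.
  by rewrite ltr_int => /ltW.
have slo : \sum_(i < q) ((p * i%:Z + (k - 1)) %/ q)%Z%:~R <=
    \sum_(i < q) (Num.floor (x * i%:R + y))%:~R :> R.
  by apply: ler_sum => i _; rewrite ler_int.
have shi : \sum_(i < q) (Num.floor (x * i%:R + y))%:~R <=
    \sum_(i < q) ((p * i%:Z + (k + 2)) %/ q)%Z%:~R :> R.
  by apply: ler_sum => i _; rewrite ler_int.
rewrite sum_divz_coprime// in slo; rewrite sum_divz_coprime// in shi.
rewrite !big_split/= !sumrN !big_split/= -mulr_sumr !sumr_const card_ord
  sum_ord.
rewrite rmorphB/= in slo; rewrite rmorphD/= in shi.
rewrite -[_ *+ q]mulr_natl -[y *+ q]mulr_natl.
have -> : x * (q%:R * (q%:R - 1) / 2) = (p%:~R + e) * (q%:R - 1) / 2.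
  by rewrite {1}xE; field; rewrite gt_eqF.
move: slo shi; set S := \sum_(i < q) _ => slo shi.
have e1 : `|e * (q%:R - 1)| <= 1.
  rewrite normrM (ger0_norm (_ : 0 <= q%:R - 1)) ?subr_ge0 ?ler1n//.
  by apply: le_trans eq1; rewrite ler_wpM2l// gerBl.
(* The products of [p] and [q] cancel. What remains is [1/2 + (k - q y) - e (q - 1) / 2] plus a
   number between -1 and 2. *)
by move: e1; rewrite !ler_norml => /andP[? ?]; apply/andP; split; lra.
Qed.

(** Strong induction on [n]: Dirichlet's theorem splits off a block of length [q >= c n], which
    costs at most 3, while [ln n] drops by at least [c]; the factor [3 / c] balances the two.
    Uniformity in [y] lets the remaining terms be treated as a new sum starting at 0. *)
Lemma sum_floor_badly_approximable (R : realType) (x : R) :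
    badly_approximable x ->
  exists2 K : R, 0 < K & forall (n : nat) (y : R),
    `|\sum_(i < n) ((Num.floor (x * i%:R + y))%:~R + 2^-1 - (x * i%:R + y))|
      <= K * (1 + ln n%:R).
Proof.
move=> [c0 c00 c0P].
(* Since [|p| + |q| <= (|x| + 2) q] and [|q x - p| <= 1 / n], bad approximability gives
   [c0 n <= (|x| + 2) q]. The cap at 1 yields [3 <= 3 / c], which covers a last block with nothing
   left over. *)
pose c := Num.min 1 (c0 / (`|x| + 2)).
have X0 : 0 < `|x| + 2 by rewrite ltr_wpDl.
have c_gt0 : 0 < c by rewrite lt_min ltr01 divr_gt0.
have c_le1 : c <= 1 by rewrite ge_min lexx.
exists (3 / c); first by rewrite divr_gt0.
have K3 : 3 <= 3 / c by rewrite ler_pdivlMr// ler_piMr.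
move=> n; have [m] := ubnP n; elim: m n => // m IH n nm y.
(* For the empty sum, [ln 0] has the default value 0. *)
have [->|n0] := posnP n.
  by rewrite big_ord0 normr0 ln0// addr0 mulr1 (le_trans _ K3).
have n0R : 0 < n%:R :> R by rewrite ltr0n.
have [q [p [/andP[q0 qn] cpq e1]]] := dirichlet_approximation x n0.
have q0R : 0 < q%:R :> R by rewrite ltr0n.
have e2 : `|q%:R * x - p%:~R| * q%:R <= 1.
  by apply: le_trans e1; rewrite ler_wpM2l// ler_nat.
have cnq : c * n%:R <= q%:R.
  have e3 : `|q%:R * x - p%:~R| <= 1.
    by apply: le_trans e2; rewrite ler_peMr// ler1n.
  have pq : (`|p| + `|q%:Z|)%:~R <= (`|x| + 2) * q%:R :> R.
    rewrite rmorphD/= !intr_norm -[q%:~R]/(q%:R).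
    have -> : p%:~R = q%:R * x - (q%:R * x - p%:~R) by ring.
    have := ler_normB (q%:R * x) (q%:R * x - p%:~R).
    rewrite normrM ger0_norm//; have : 1 <= q%:R :> R by rewrite ler1n.
    by lra.
  have pq0 : (p != 0) || (q%:Z != 0) by case: (q) q0 => // ? _; rewrite orbT.
  have h := c0P _ _ pq0.
  have {}h : c0 * n%:R <= (`|x| + 2) * q%:R.
    apply: le_trans (ler_wpM2r (ltW n0R) h) _; rewrite mulrAC -[q%:~R]/(q%:R).
    by apply: le_trans (ler_wpM2l _ pq) _;
      rewrite ?mulr_ge0// ler_piMl ?mulr_ge0// ltW.
  apply: (@le_trans _ _ (c0 / (`|x| + 2) * n%:R)).
    by rewrite ler_pM2r// ge_min lexx orbT.
  by rewrite mulrAC ler_pdivrMr// [leRHS]mulrC.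
move: (subnKC qn); move: (n - q)%N => r nE.
have splitE (F : nat -> R) :
    \sum_(i < n) F i = \sum_(i < q) F i + \sum_(i < r) F (q + i)%N.
  by rewrite -nE big_split_ord.
rewrite (splitE (fun i =>
  (Num.floor (x * i%:R + y))%:~R + 2^-1 - (x * i%:R + y))).
apply: le_trans (ler_normD _ _) _.
have h1 := @sum_floor_block R x y q p q0 cpq e2.
have c30 : 0 < 3 / c by rewrite divr_gt0.
have [r0|r0] := posnP r.
  rewrite r0 [X in _ + `|X| <= _]big_ord0 normr0 addr0.
  apply: le_trans h1 _.
  by apply: le_trans K3 _; rewrite ler_peMr ?(ltW c30)// lerDl ln_ge0// ler1n.
have r0R : 0 < r%:R :> R by rewrite ltr0n.
have h2 : `|\sum_(i < r) ((Num.floor (x * (q + i)%:R + y))%:~R + 2^-1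
    - (x * (q + i)%:R + y))| <= 3 / c * (1 + ln r%:R).
  under eq_bigr => i _.
    have -> : x * (q + i)%:R + y = x * i%:R + (x * q%:R + y) by rewrite natrD;
      ring.
    over.
  apply: IH; apply: leq_trans (_ : n <= m)%N => //.
  by rewrite -nE -add1n leq_add2r.
apply: le_trans (lerD h1 h2) _.
(* Here [r = n (1 - q / n)] and [ln (1 - q / n) <= - q / n <= - c]. *)
have : ln r%:R <= ln n%:R - c.
  have rE : r%:R = n%:R * (1 + - (q%:R / n%:R)) :> R.
    by rewrite mulrDr mulr1 mulrN mulrCA divff ?gt_eqF// mulr1 -nE natrD addrC
      addKr.
  have s0 : 0 < 1 + - (q%:R / n%:R) :> R by rewrite -(pmulr_rgt0 _ n0R) -rE.
  rewrite rE lnM ?posrE// lerD2l; apply: le_trans (le_ln1Dx _) _.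
    by lra.
  by rewrite lerN2 ler_pdivlMr.
rewrite -(ler_pM2l c30) mulrBr mulfVK ?gt_eqF//; lra.
Qed.

(** * Lattice points in triangles *)

Lemma sum_floor_nat_itv (R : realType) (x : R) :
    badly_approximable x ->
  exists2 K : R, 0 < K & forall (W m n : nat) (y : R), (n <= W)%N ->
    (0 < W)%N ->
    `|\sum_(m <= i < n) ((Num.floor (x * i%:R + y))%:~R + 2^-1 - (x * i%:R +
      y))|
      <= K * (1 + ln W%:R).
Proof.
move=> /sum_floor_badly_approximable[K K0 KP]; exists K => // W m n y nW W0.
rewrite -[m]add0n big_addn big_mkord.
under eq_bigr => i _.
  have -> : x * (i + m)%:R + y = x * i%:R + (x * m%:R + y) by rewrite natrD;
    ring.
  over.
apply: le_trans (KP _ _) _; rewrite ler_pM2l// lerD2l.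
have [->|d0] := posnP (n - m)%N; first by rewrite ln0// ln_ge0// ler1n.
by rewrite ler_ln ?posrE ?ltr0n// ler_nat (leq_trans (leq_subr _ _)).
Qed.

Lemma sum_ltn (W k : nat) : (k <= W)%N -> (\sum_(j < W) (j < k) = k)%N.
Proof.
move=> kW; transitivity (\sum_(j < k) 1)%N;
  last by rewrite sum_nat_const card_ord muln1.
by rewrite (big_ord_widen W (fun=> 1%N))// [RHS]big_mkcond/=;
  apply: eq_bigr => j _; case: ltnP.
Qed.

(** Writing the lower end through [floor (- l)] gives both ends the same shape [floor z + 1/2], so
    that upper and lower edges lead to the same kind of sawtooth sum. *)
Lemma count_nat_itv (R : realType) (W : nat) (l u : R) :
    0 <= l -> l <= u -> u < W%:R ->
  \sum_(j < W) (l <= j%:R <= u)%R%:R =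
    ((Num.floor u)%:~R + 2^-1) + ((Num.floor (- l))%:~R + 2^-1) :> R.
Proof.
move=> l0 lu uW; have u0 := le_trans l0 lu.
have fu0 : 0 <= Num.floor u by rewrite floor_ge0.
have fl0 : Num.floor (- l) <= 0 by rewrite floor_le0; lra.
(* These count the naturals that are at most [u] and those below [l]. *)
pose k := `|Num.floor u|.+1; pose m := `|Num.floor (- l)|%N.
have kE (j : nat) : (j < k)%N = (j%:R <= u).
  by rewrite /k ltnS -lez_nat gez0_abs// floor_ge_int.
have mE (j : nat) : (j < m)%N = (j%:R < l).
  rewrite /m -ltz_nat lez0_abs// ltrNr -[- l]/(- l) floor_lt_int.
  by rewrite rmorphN/= ltrN2.
have kW : (k <= W)%N by rewrite /k -ltz_nat gez0_abs// floor_lt_int.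
have mk : (m <= k)%N.
  by rewrite leqNgt; apply/negP; rewrite mE => h; have := kE k;
    rewrite ltnn => /esym; lra.
have split_ (j : 'I_W) : (l <= j%:R <= u)%R%:R = (j < k)%N%:R - (j < m)%N%:R :>
  R.
  rewrite kE mE; case: (leP l j%:R) => h /=; first by rewrite subr0.
  rewrite (_ : j%:R <= u) ?subrr//; lra.
under eq_bigr do rewrite split_.
rewrite big_split/= sumrN -!natr_sum sum_ltn// sum_ltn ?(leq_trans mk)//.
rewrite /k -natr1 !natr_absz ger0_norm// ler0_norm// rmorphN/=; lra.
Qed.

(* Trapezoidal rule for a tent function: the first-order errors of the two
   slopes at the apex cancel. *)
Lemma tent_sum (R : realType) (a b x0 x1 x2 : R) (A B C : nat) :
    0 <= a -> 0 <= b -> a * (x1 - x0) = b * (x2 - x1) ->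
    A%:R - 1 < x0 <= A%:R -> B%:R - 1 <= x1 < B%:R -> C%:R - 1 <= x2 < C%:R ->
    (A <= B)%N -> (B <= C)%N ->
  `|\sum_(A <= i < B) a * (i%:R - x0) + \sum_(B <= i < C) b * (x2 - i%:R)
    - a * (x1 - x0) * (x2 - x0) / 2| <= a + b.
Proof.
move=> a0 b0 ab /andP[A1 A2] /andP[B1 B2] /andP[C1 C2] AB BC.
have sumA (m n : nat) : (m <= n)%N ->
    \sum_(m <= i < n) (i%:R : R) = (n%:R * (n%:R - 1) - m%:R * (m%:R - 1)) / 2.
  move=> mn; apply: (addrI (\sum_(0 <= i < m) i%:R)).
  by rewrite -big_cat_nat//= !big_mkord !sum_ord; field.
have sumc (m n : nat) (c : R) : (m <= n)%N ->
  \sum_(m <= i < n) c = (n%:R - m%:R) * c.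
  by move=> mn; rewrite sumr_const_nat -[LHS]mulr_natl natrB.
rewrite -!mulr_sumr !big_split/= !sumrN !sumA// !sumc//.
(* The error is an exact expression in the offsets [t] of the three nodes, through [t (1 - t)],
   which lies in [[0, 1]]. The identity holds modulo the apex relation [ab], of which a multiple is
   subtracted. *)
pose al := A%:R - x0; pose be := B%:R - x1; pose ga := C%:R - x2.
rewrite [X in `|X|](_ : _ = 2^-1 * (a * (al * (1 - al) - be * (1 - be))
    + b * (ga * (1 - ga) - be * (1 - be)))); last first.
  apply/eqP; rewrite -subr_eq0; apply/eqP.
  transitivity ((x2 - x1 - 2 * be + 1) * (b * (x2 - x1) - a * (x1 - x0)) / 2).
    by rewrite /al /be /ga; field.
  by rewrite ab subrr mulr0 mul0r.
have q01 (t : R) : 0 <= t -> t <= 1 -> 0 <= t * (1 - t) <= 1.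
  by move=> t0 t1; rewrite mulr_ge0 ?subr_ge0// mulr_ile1 ?subr_ge0// gerBl.
have /andP[h1 h2] := q01 al ltac:(rewrite /al; lra) ltac:(rewrite /al; lra).
have /andP[h3 h4] := q01 be ltac:(rewrite /be; lra) ltac:(rewrite /be; lra).
have /andP[h5 h6] := q01 ga ltac:(rewrite /ga; lra) ltac:(rewrite /ga; lra).
move: h1 h2 h3 h4 h5 h6;
  move: (al * _) (be * _) (ga * _) => X Y Z h1 h2 h3 h4 h5 h6.
have := mulr_ge0 a0 h1; have := mulr_ge0 a0 h3; have := mulr_ge0 b0 h3;
  have := mulr_ge0 b0 h5.
have : a * X <= a by rewrite ler_piMr.
have : a * Y <= a by rewrite ler_piMr.
have : b * Y <= b by rewrite ler_piMr.
have : b * Z <= b by rewrite ler_piMr.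
by move=> *; rewrite ler_norml; apply/andP; split; lra.
Qed.

(** With these signs the first two constraints bound [y] below by lines [l1], [l2] and the third
    bounds it above by a line [u]. The column length is a tent function: it rises from [x0], where
    [u] meets [l1], to [x1], where the lower lines cross, and falls to [x2], where [u] meets [l2].
    The box hypothesis ensures that no lattice point of the triangle is missed. *)
Lemma count_triangle_upright (R : realType) (p1 q1 p2 q2 : R) :
    0 < p1 -> 0 < p2 -> 0 < p2 * q1 - p1 * q2 ->
    badly_approximable (q1 / p1) -> badly_approximable (q2 / p2) ->
    badly_approximable ((q1 + q2) / (p1 + p2)) ->
  exists2 K : R, 0 < K & forall (W : nat) (g1 g2 g3 : R), (0 < W)%N ->
    g1 + g2 + g3 <= 0 ->
    (forall x y : R, g1 <= p1 * y + q1 * x -> g2 <= p2 * y + q2 * x ->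
       g3 <= - (p1 + p2) * y - (q1 + q2) * x ->
       0 <= x < W%:R /\ 0 <= y < W%:R) ->
  `|\sum_(i < W) \sum_(j < W)
      [&& g1 <= p1 * j%:R + q1 * i%:R, g2 <= p2 * j%:R + q2 * i%:R &
          g3 <= - (p1 + p2) * j%:R - (q1 + q2) * i%:R]%R%:R
    - (g1 + g2 + g3) ^+ 2 / (2 * (p2 * q1 - p1 * q2))| <= K * (1 + ln W%:R).
Proof.
set E := p2 * q1 - p1 * q2; move=> p1_gt0 p2_gt0 det_gt0; set P := p1 + p2;
  set Q := q1 + q2.
have P0 : 0 < P by rewrite addr_gt0.
have p1n : p1 != 0 by rewrite gt_eqF.
have p2n : p2 != 0 by rewrite gt_eqF.
have Pn : P != 0 by rewrite gt_eqF.
have En : E != 0 by rewrite gt_eqF.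
move=> /sum_floor_nat_itv[K1 K10 K1P] /sum_floor_nat_itv[K2 K20 K2P].
move=> /badly_approximableN/sum_floor_nat_itv[K3 K30 K3P].
pose a := E / (P * p1); pose b := E / (P * p2).
have a0 : 0 < a by rewrite divr_gt0// mulr_gt0.
have b0 : 0 < b by rewrite divr_gt0// mulr_gt0.
(* The upper edge is met on both sides of the apex, hence [2 * K3]; [a + b] is the error of the
   trapezoidal rule. *)
exists (K1 + K2 + 2 * K3 + (a + b)); first by rewrite !addr_gt0// mulr_gt0.
move=> W g1 g2 g3 W0 g0 box.
pose s := - (g1 + g2 + g3).
have s0 : 0 <= s by rewrite oppr_ge0.
pose l1 x := (g1 - q1 * x) / p1; pose l2 x := (g2 - q2 * x) / p2.
pose u x := (- g3 - Q * x) / P.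
have c1 x y : (g1 <= p1 * y + q1 * x) = (l1 x <= y).
  by rewrite /l1 ler_pdivrMr// lerBlDr [y * _]mulrC.
have c2 x y : (g2 <= p2 * y + q2 * x) = (l2 x <= y).
  by rewrite /l2 ler_pdivrMr// lerBlDr [y * _]mulrC.
have c3 x y : (g3 <= - P * y - Q * x) = (y <= u x).
  by rewrite /u ler_pdivlMr//; apply/idP/idP; lra.
have {}box x y : l1 x <= y -> l2 x <= y -> y <= u x ->
  0 <= x < W%:R /\ 0 <= y < W%:R.
  by rewrite -c1 -c2 -c3; exact: box.
under eq_bigr => i _ do under eq_bigr => j _ do rewrite c1 c2 c3.
pose x0 := (p1 * g3 + P * g1) / E; pose x1 := (g1 * p2 - g2 * p1) / E.
pose x2 := - (p2 * g3 + P * g2) / E.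
pose e := E / (p1 * p2).
have e0 : 0 < e by rewrite divr_gt0// mulr_gt0.
have ul1 x : u x - l1 x = a * (x - x0).
  by rewrite /u /l1 /a /x0 /Q /P /E; field; move: Pn En p1n p2n;
    rewrite /P /E => H1 H2 H3 H4; rewrite ?H1 ?H2 ?H3 ?H4.
have ul2 x : u x - l2 x = b * (x2 - x).
  by rewrite /u /l2 /b /x2 /Q /P /E; field; move: Pn En p1n p2n;
    rewrite /P /E => H1 H2 H3 H4; rewrite ?H1 ?H2 ?H3 ?H4.
have ll x : l1 x - l2 x = e * (x1 - x).
  by rewrite /l1 /l2 /e /x1 /E; field; move: Pn En p1n p2n;
    rewrite /P /E => H1 H2 H3 H4; rewrite ?H1 ?H2 ?H3 ?H4.
have x01 : x1 - x0 = p1 * s / E by rewrite /x1 /x0 /s /P; field.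
have x12 : x2 - x1 = p2 * s / E by rewrite /x1 /x2 /s /P; field.
have x01_ge0 : x0 <= x1 by rewrite -subr_ge0 x01 divr_ge0 ?mulr_ge0 ?(ltW
  p1_gt0) ?(ltW p2_gt0) ?(ltW det_gt0).
have x12_ge0 : x1 <= x2 by rewrite -subr_ge0 x12 divr_ge0 ?mulr_ge0 ?(ltW
  p1_gt0) ?(ltW p2_gt0) ?(ltW det_gt0).
have [x0p x2W] : 0 <= x0 /\ x2 < W%:R.
  have u0 : u x0 = l1 x0 by apply/eqP; rewrite -subr_eq0 ul1 subrr mulr0.
  have u2 : u x2 = l2 x2 by apply/eqP; rewrite -subr_eq0 ul2 subrr mulr0.
  split.
    have [] := box x0 (l1 x0); rewrite ?u0//; last by case/andP.
    by rewrite -subr_ge0 ll pmulr_rge0// subr_ge0.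
  have [] := box x2 (l2 x2); rewrite ?u2//; last by case/andP.
  by rewrite -subr_le0 ll pmulr_rle0// subr_le0.
(* The columns meeting the triangle are [A <= i < B], bounded below by [l1], and [B <= i < C],
   bounded below by [l2]. Here [A] is the first integer at or after [x0], while [B] and [C] are the
   first ones strictly after [x1] and [x2]. *)
pose A := `|Num.ceil x0|%N.
pose B := (`|Num.floor x1|%N).+1; pose C := (`|Num.floor x2|%N).+1.
have AE : (A%:R : R) = (Num.ceil x0)%:~R.
  by rewrite /A natr_absz ger0_norm// ceil_ge0; lra.
have BE : (B%:R : R) = (Num.floor x1)%:~R + 1.
  by rewrite /B -natr1 natr_absz ger0_norm// floor_ge0; lra.
have CE : (C%:R : R) = (Num.floor x2)%:~R + 1.
  by rewrite /C -natr1 natr_absz ger0_norm// floor_ge0; lra.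
have Ax : A%:R - 1 < x0 <= A%:R.
  rewrite AE ceil_ge andbT; have := ceilB1_lt x0; rewrite rmorphB/=; lra.
have Bx : B%:R - 1 <= x1 < B%:R.
  rewrite BE; have := floorD1_gt x1; have := floor_le x1; rewrite rmorphD/=;
    lra.
have Cx : C%:R - 1 <= x2 < C%:R.
  rewrite CE; have := floorD1_gt x2; have := floor_le x2; rewrite rmorphD/=;
    lra.
have ltN (m n : nat) : m%:R - 1 < n%:R :> R -> (m <= n)%N.
  by rewrite ltrBlDr natr1 ltr_nat ltnS.
have AB : (A <= B)%N by apply: ltN; move/andP: Ax => [] ? ?;
  move/andP: Bx => [] ? ?; lra.
have BC : (B <= C)%N by apply: ltN; move/andP: Cx => [] ? ?;
  move/andP: Bx => [] ? ?; lra.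
have CW : (C <= W)%N by apply: ltN; move/andP: Cx => [] ? ?; lra.
pose col (i : nat) : R := \sum_(j < W) [&& l1 i%:R <= j%:R, l2 i%:R <= j%:R &
  j%:R <= u i%:R]%R%:R.
rewrite -(big_mkord xpredT col).
have colA i : (i < A)%N -> col i = 0.
  move=> iA; have iA' : i%:R < x0.
    rewrite ltNge; apply/negP => h; move: iA; rewrite ltnNge => /negP; apply;
      apply: ltN.
    by move/andP: Ax => [] ? ?; lra.
  rewrite /col big1// => j _; case: (leP (l1 _)) => //= h1;
    case: (leP (l2 _)) => //= h2.
  case: leP => //= h3; exfalso.
  have : u i%:R - l1 i%:R < 0 by rewrite ul1 pmulr_rlt0// subr_lt0.
  lra.
have colC i : (C <= i)%N -> col i = 0.
  move=> iC; have iC' : x2 < i%:R.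
    by move/andP: Cx => [] _ h; apply: lt_le_trans h _; rewrite ler_nat.
  rewrite /col big1// => j _; case: (leP (l1 _)) => //= h1;
    case: (leP (l2 _)) => //= h2.
  case: leP => //= h3; exfalso.
  have : u i%:R - l2 i%:R < 0 by rewrite ul2 pmulr_rlt0// subr_lt0.
  lra.
pose fl (z : R) : R := (Num.floor z)%:~R + 2^-1.
have colAB i : (A <= i < B)%N -> col i = fl (u i%:R) + fl (- l1 i%:R).
  move=> /andP[Ai iB].
  have h0 : x0 <= i%:R by move/andP: Ax => [] _ h; apply: le_trans h _;
    rewrite ler_nat.
  have h1 : i%:R <= x1.
    by move/andP: Bx => [] h _; apply: le_trans h;
      rewrite lerBrDr natr1 ler_nat.
  have l21 : l2 i%:R <= l1 i%:R by rewrite -subr_ge0 ll pmulr_rge0// subr_ge0.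
  have l1u : l1 i%:R <= u i%:R by rewrite -subr_ge0 ul1 pmulr_rge0// subr_ge0.
  have [_ /andP[b1 _]] := box i%:R (l1 i%:R) (lexx _) l21 l1u.
  have [_ /andP[_ b2]] := box i%:R (u i%:R) l1u (le_trans l21 l1u) (lexx _).
  rewrite /fl -(count_nat_itv b1 l1u b2); apply: eq_bigr => j _.
  case: (leP (l1 _)) => //= h; congr ((_ _)%:R).
  by rewrite (le_trans l21 h).
have colBC i : (B <= i < C)%N -> col i = fl (u i%:R) + fl (- l2 i%:R).
  move=> /andP[Bi iC].
  have h0 : x1 <= i%:R.
    by move/andP: Bx => [] _ h; apply/ltW; apply: lt_le_trans h _;
      rewrite ler_nat.
  have h1 : i%:R <= x2.
    by move/andP: Cx => [] h _; apply: le_trans h;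
      rewrite lerBrDr natr1 ler_nat.
  have l12 : l1 i%:R <= l2 i%:R by rewrite -subr_le0 ll pmulr_rle0// subr_le0.
  have l2u : l2 i%:R <= u i%:R by rewrite -subr_ge0 ul2 pmulr_rge0// subr_ge0.
  have [_ /andP[b1 _]] := box i%:R (l2 i%:R) l12 (lexx _) l2u.
  have [_ /andP[_ b2]] := box i%:R (u i%:R) (le_trans l12 l2u) l2u (lexx _).
  rewrite /fl -(count_nat_itv b1 l2u b2); apply: eq_bigr => j _.
  case: (leP (l2 _)) => //= h; rewrite ?andbF//.
  by rewrite (le_trans l12 h).
have -> : \sum_(0 <= i < W) col i = \sum_(A <= i < B) (fl (u i%:R) + fl (- l1
  i%:R))
    + \sum_(B <= i < C) (fl (u i%:R) + fl (- l2 i%:R)).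
  rewrite (@big_cat_nat _ _ _ C)//= [X in _ + X]big_nat_cond [X in _ + X]big1
    ?addr0; last first.
    by move=> i /andP[/andP[? _] _]; exact: colC.
  rewrite (@big_cat_nat _ _ _ A)//= ?(leq_trans AB)// big_nat_cond big1 ?add0r;
    last first.
    by move=> i /andP[/andP[_ ?] _]; exact: colA.
  by rewrite (@big_cat_nat _ _ _ B)//=; congr (_ + _); apply: eq_big_nat.
(* Each column count is the column length plus one sawtooth error for each end; the lengths go to
   [tent_sum], the errors to the sawtooth bounds. *)
pose err (z : R) := fl z - z.
have decomp (m n : nat) (f g : R -> R) :
    \sum_(m <= i < n) (fl (f i%:R) + fl (- g i%:R)) =
    \sum_(m <= i < n) err (f i%:R) + \sum_(m <= i < n) err (- g i%:R)
      + \sum_(m <= i < n) (f i%:R - g i%:R).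
  by rewrite -!big_split/=; apply: eq_bigr => i _; rewrite /err; ring.
rewrite !decomp.
have -> : \sum_(A <= i < B) (u i%:R - l1 i%:R) = \sum_(A <= i < B) a * (i%:R -
  x0).
  by apply: eq_bigr => i _; rewrite ul1.
have -> : \sum_(B <= i < C) (u i%:R - l2 i%:R) = \sum_(B <= i < C) b * (x2 -
  i%:R).
  by apply: eq_bigr => i _; rewrite ul2.
have -> : (g1 + g2 + g3) ^+ 2 / (2 * E) = a * (x1 - x0) * (x2 - x0) / 2.
  rewrite (_ : x2 - x0 = (x2 - x1) + (x1 - x0)); last by ring.
  rewrite x01 x12 -sqrrN -/s /a /P /E; field.
  by move: Pn En p1n p2n; rewrite /P /E => H1 H2 H3 H4; rewrite ?H1 ?H2 ?H3 ?H4.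
have apex : a * (x1 - x0) = b * (x2 - x1).
  by rewrite x01 x12 /a /b; field; rewrite p1n p2n Pn En.
have tent := tent_sum (ltW a0) (ltW b0) apex Ax Bx Cx AB BC.
have errU (m n : nat) : (n <= W)%N ->
    `|\sum_(m <= i < n) err (u i%:R)| <= K3 * (1 + ln W%:R).
  move=> nW; rewrite (eq_bigr (fun i : nat =>
    (Num.floor (- (Q / P) * i%:R + - g3 / P))%:~R
      + 2^-1 - (- (Q / P) * i%:R + - g3 / P))); first exact: K3P.
  move=> i _; rewrite /err /fl (_ : u _ = - (Q / P) * i%:R + - g3 / P)//.
  by rewrite /u; field.
have err1 (m n : nat) : (n <= W)%N ->
    `|\sum_(m <= i < n) err (- l1 i%:R)| <= K1 * (1 + ln W%:R).
  move=> nW; rewrite (eq_bigr (fun i : nat =>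
    (Num.floor ((q1 / p1) * i%:R + - g1 / p1))%:~R
      + 2^-1 - ((q1 / p1) * i%:R + - g1 / p1))); first exact: K1P.
  move=> i _; rewrite /err /fl (_ : - l1 _ = (q1 / p1) * i%:R + - g1 / p1)//.
  by rewrite /l1; field.
have err2 (m n : nat) : (n <= W)%N ->
    `|\sum_(m <= i < n) err (- l2 i%:R)| <= K2 * (1 + ln W%:R).
  move=> nW; rewrite (eq_bigr (fun i : nat =>
    (Num.floor ((q2 / p2) * i%:R + - g2 / p2))%:~R
      + 2^-1 - ((q2 / p2) * i%:R + - g2 / p2))); first exact: K2P.
  move=> i _; rewrite /err /fl (_ : - l2 _ = (q2 / p2) * i%:R + - g2 / p2)//.
  by rewrite /l2; field.
have := errU A B (leq_trans BC CW); have := errU B C CW.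
have := err1 A B (leq_trans BC CW); have := err2 B C CW.
have L0 : 0 <= ln W%:R :> R by rewrite ln_ge0// ler1n.
have ab0 : a + b <= (a + b) * (1 + ln W%:R) by rewrite ler_peMr ?addr_ge0 ?(ltW
  a0) ?(ltW b0)// lerDl.
move: tent ab0; set S1 := \sum_(A <= i < B) a * _;
  set S2 := \sum_(B <= i < C) b * _.
set T1 := \sum_(A <= i < B) _; set T2 := \sum_(A <= i < B) _.
set T3 := \sum_(B <= i < C) _; set T4 := \sum_(B <= i < C) _.
move: (a * _ * _ / 2) (1 + ln _) => Z L.
rewrite !ler_norml !mulrDl =>
  tent ab0 /andP[? ?] /andP[? ?] /andP[? ?] /andP[? ?].
move/andP: tent => [? ?].
by apply/andP; split; lra.
Qed.

(* The affine functions [P_k y + Q_k x - g_k] sum to [- (g1 + g2 + g3)], hence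
   the region where they are all nonnegative is a triangle of area
   [(g1 + g2 + g3)^2 / (2 E)], [E] being the common absolute value of the
   determinants of pairs of the forms. *)
Definition triangle_count_bound (R : realType) (E P1 Q1 P2 Q2 P3 Q3 : R) : Prop
  :=
  exists2 K : R, 0 < K & forall (W : nat) (g1 g2 g3 : R), (0 < W)%N ->
    g1 + g2 + g3 <= 0 ->
    (forall x y : R, g1 <= P1 * y + Q1 * x -> g2 <= P2 * y + Q2 * x ->
       g3 <= P3 * y + Q3 * x ->
       0 <= x <= W%:R - 1 /\ 0 <= y <= W%:R - 1) ->
  `|\sum_(i < W) \sum_(j < W)
      [&& g1 <= P1 * j%:R + Q1 * i%:R, g2 <= P2 * j%:R + Q2 * i%:R &
          g3 <= P3 * j%:R + Q3 * i%:R]%R%:R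
    - (g1 + g2 + g3) ^+ 2 / (2 * E)| <= K * (1 + ln W%:R).

Lemma triangle_count_bound_swap (R : realType) (E P1 Q1 P2 Q2 P3 Q3 : R) :
  triangle_count_bound E P1 Q1 P2 Q2 P3 Q3 ->
    triangle_count_bound E P2 Q2 P1 Q1 P3 Q3.
Proof.
move=> [K K0 KP]; exists K => // W g1 g2 g3 W0;
  rewrite [g1 + g2]addrC => g0 box.
under eq_bigr => i _ do under eq_bigr => j _ do rewrite andbCA.
by apply: KP => // x y h1 h2 h3; exact: box.
Qed.

Lemma triangle_count_bound_rot (R : realType) (E P1 Q1 P2 Q2 P3 Q3 : R) :
  triangle_count_bound E P1 Q1 P2 Q2 P3 Q3 ->
    triangle_count_bound E P2 Q2 P3 Q3 P1 Q1.
Proof.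
move=> [K K0 KP]; exists K => // W g1 g2 g3 W0.
rewrite (_ : g1 + g2 + g3 = g3 + g1 + g2); last by ring.
move=> g0 box.
under eq_bigr => i _ do under eq_bigr => j _ do rewrite andbA andbC.
by apply: KP => // x y h1 h2 h3; exact: box.
Qed.

(** The reflection [y -> W - 1 - y] permutes the rows of the box and negates the [P_k]; the shifts
    of the [g_k] cancel because the [P_k] sum to 0. *)
Lemma triangle_count_bound_flip (R : realType) (E P1 Q1 P2 Q2 P3 Q3 : R) :
    P1 + P2 + P3 = 0 ->
  triangle_count_bound E (- P1) Q1 (- P2) Q2 (- P3) Q3 ->
  triangle_count_bound E P1 Q1 P2 Q2 P3 Q3.
Proof.
move=> P0 [K K0 KP]; exists K => // W g1 g2 g3 W0 g0 box.
pose w : R := W%:R - 1.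
have e (P Q x y g : R) : (g - P * w <= - P * y + Q * x) = (g <= P * (w - y) + Q
  * x).
  by apply/idP/idP; lra.
have sE : g1 - P1 * w + (g2 - P2 * w) + (g3 - P3 * w) = g1 + g2 + g3.
  by rewrite (_ : P3 = - (P1 + P2)); [ring|lra].
have := KP W (g1 - P1 * w) (g2 - P2 * w) (g3 - P3 * w) W0.
rewrite sE => /(_ g0) H.
rewrite (_ : \sum_(i < W) _ = \sum_(i < W) \sum_(j < W)
      [&& g1 - P1 * w <= - P1 * j%:R + Q1 * i%:R, g2 - P2 * w <= - P2 * j%:R +
        Q2 * i%:R &
          g3 - P3 * w <= - P3 * j%:R + Q3 * i%:R]%R%:R).
  apply: H => x y; rewrite !e => h1 h2 h3.
  have [? /andP[b1 b2]] := box _ _ h1 h2 h3; split => //; move: b1 b2;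
    rewrite /w => b1 b2.
  by apply/andP; split; lra.
apply: eq_bigr => i _; rewrite (reindex_inj rev_ord_inj)/=;
  apply: eq_bigr => j _.
rewrite !e (_ : (W - j.+1)%:R = w - j%:R)//.
by rewrite natrB// -natr1 /w; ring.
Qed.

Lemma triangle_count_bound_pos (R : realType) (P1 Q1 P2 Q2 P3 Q3 : R) :
    0 < P1 -> 0 < P2 -> P1 + P2 + P3 = 0 -> Q1 + Q2 + Q3 = 0 ->
    0 < P2 * Q1 - P1 * Q2 ->
    badly_approximable (Q1 / P1) -> badly_approximable (Q2 / P2) ->
    badly_approximable (Q3 / P3) ->
  triangle_count_bound (P2 * Q1 - P1 * Q2) P1 Q1 P2 Q2 P3 Q3.
Proof.
move=> P10 P20 P0 Q0 E0 b1 b2 b3.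
have PE : P3 = - (P1 + P2) by lra.
have QE : Q3 = - (Q1 + Q2) by lra.
rewrite PE QE invrN mulrNN in b3 *.
have [K K0 KP] := count_triangle_upright P10 P20 E0 b1 b2 b3.
exists K => // W g1 g2 g3 W0 g0 box.
under eq_bigr => i _ do under eq_bigr => j _ do rewrite [- (Q1 + Q2) * _]mulNr.
apply: KP => // x y h1 h2; rewrite -mulNr => h3.
by have [/andP[? ?] /andP[? ?]] := box _ _ h1 h2 h3; split; apply/andP;
  split => //; lra.
Qed.

(** A reflection makes [P1] and [P2] positive, and exchanging the first two forms then makes the
    determinant positive. *)
Lemma triangle_count_bound_same_sign (R : realType) (P1 Q1 P2 Q2 P3 Q3 E : R) :
    0 < P1 * P2 -> P1 + P2 + P3 = 0 -> Q1 + Q2 + Q3 = 0 ->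
    0 < E -> `|P2 * Q1 - P1 * Q2| = E ->
    badly_approximable (Q1 / P1) -> badly_approximable (Q2 / P2) ->
    badly_approximable (Q3 / P3) ->
  triangle_count_bound E P1 Q1 P2 Q2 P3 Q3.
Proof.
move=> P12 P0 Q0 E0.
wlog P10 : P1 P2 P3 P12 P0 / 0 < P1.
  move=> H; have [P10|P10] := ltP 0 P1; first exact: H.
  move=> EE b1 b2 b3; apply: triangle_count_bound_flip => //.
  apply: H; rewrite ?mulrNN ?invrN ?mulrN//.
  - by rewrite -!opprD P0 oppr0.
  - by rewrite oppr_gt0 lt_neqAle P10 andbT; apply: contraTneq P12 => ->;
      rewrite mul0r ltxx.
  - by rewrite !mulNr -opprD normrN.
  - exact: badly_approximableN.
  - exact: badly_approximableN.
  - exact: badly_approximableN.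
have P20 : 0 < P2 by rewrite -(pmulr_rgt0 _ P10).
have [D0|D0 EE] := ltP 0 (P2 * Q1 - P1 * Q2).
  by move=> <- b1 b2 b3; rewrite gtr0_norm//; exact: triangle_count_bound_pos.
move=> b1 b2 b3; apply: triangle_count_bound_swap.
have -> : E = P1 * Q2 - P2 * Q1 by rewrite -EE ler0_norm// opprB.
apply: triangle_count_bound_pos => //; last 1 first.
- by rewrite -opprB -(ler0_norm D0) EE.
- by rewrite [P2 + _]addrC.
- by rewrite [Q2 + _]addrC.
Qed.

(** Two of three nonzero reals have the same sign, and a cyclic shift brings them to the front. All
    pairs of forms have the same determinant up to sign because the forms sum to 0. *)
Lemma triangle_count (R : realType) (P1 Q1 P2 Q2 P3 Q3 E : R) :
    P1 != 0 -> P2 != 0 -> P3 != 0 -> P1 + P2 + P3 = 0 -> Q1 + Q2 + Q3 = 0 ->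
    0 < E -> `|P2 * Q1 - P1 * Q2| = E ->
    badly_approximable (Q1 / P1) -> badly_approximable (Q2 / P2) ->
    badly_approximable (Q3 / P3) ->
  triangle_count_bound E P1 Q1 P2 Q2 P3 Q3.
Proof.
move=> n1 n2 n3 P0 Q0 E0 EE b1 b2 b3.
have PE : P3 = - (P1 + P2) by lra.
have QE : Q3 = - (Q1 + Q2) by lra.
have [h|h12] := ltP 0 (P1 * P2).
  exact: triangle_count_bound_same_sign.
have [h|h23] := ltP 0 (P2 * P3).
  apply: triangle_count_bound_rot; apply: triangle_count_bound_rot.
  apply: triangle_count_bound_same_sign => //.
  - by rewrite addrC addrA.
  - by rewrite addrC addrA.
  - by rewrite -EE PE QE; congr `|_|; ring.
apply: triangle_count_bound_rot; apply: triangle_count_bound_same_sign => //.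
- have h : 0 <= P2 ^+ 2 * (P3 * P1).
    by rewrite (_ : _ * _ = (P1 * P2) * (P2 * P3)); [exact: mulr_le0|ring].
  rewrite lt_neqAle eq_sym mulf_neq0//=.
  by move: h; rewrite pmulr_rge0// exprn_even_gt0.
- by rewrite -addrA addrC.
- by rewrite -addrA addrC.
- by rewrite -EE PE QE; congr `|_|; ring.
Qed.

(** * Areas *)

Section Volume.
Variable R : realType.
Local Notation T2 := (measurableTypeR R * measurableTypeR R)%type.

Lemma measurable_halfplane (b : bool) (c : R) (f : T2 -> R) :
  measurable_fun setT f ->
  measurable ([set p | c < f p ?<= if b] : set T2).
Proof.
move=> mf; rewrite [X in measurable X](_ : _ = setT `&` f @^-1` [set` Interval
  (BSide b c) +oo%O]).
  by apply: mf => //; exact: measurable_itv.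
by apply/seteqP; split => p /=; rewrite in_itv/= andbT; [|case].
Qed.

(* [1 - p.1 - p.2], [p.2] and [p.1] are the barycentric coordinates of [p] with
   respect to the vertices of [right_triangle R]. *)
Definition coordinate_triangle (b1 b2 b3 : bool) (c1 c2 c3 : R) : set (R * R) :=
  [set p | [/\ c1 < 1 - p.1 - p.2 ?<= if b1, c2 < p.2 ?<= if b2 &
                c3 < p.1 ?<= if b3]].

Lemma measurable_coordinates :
  [/\ measurable_fun setT (fun p : T2 => 1 - p.1 - p.2 : R),
      measurable_fun setT (fun p : T2 => p.2 : R) &
      measurable_fun setT (fun p : T2 => p.1 : R)].
Proof.
split; last 2 first.
- exact: measurable_snd.
- exact: measurable_fst.
apply: measurable_realfun.measurable_funB; last exact: measurable_snd.
by apply: measurable_realfun.measurable_funB;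
  [exact: measurable_cst|exact: measurable_fst].
Qed.

Lemma measurable_coordinate_triangle (b1 b2 b3 : bool) (c1 c2 c3 : R) :
  measurable (coordinate_triangle b1 b2 b3 c1 c2 c3 : set T2).
Proof.
have [m1 m2 m3] := measurable_coordinates.
rewrite [X in measurable X](_ : _ = [set p : T2 | c1 < 1 - p.1 - p.2 ?<= if b1]
  `&` ([set p : T2 | c2 < p.2 ?<= if b2] `&`
   [set p : T2 | c3 < p.1 ?<= if b3])).
  apply: measurableI; [exact: (measurable_halfplane b1 c1 m1)|apply:
    measurableI].
  - exact: (measurable_halfplane b2 c2 m2).
  - exact: (measurable_halfplane b3 c3 m3).
by apply/seteqP; split => p /=; [move=> []|move=> [? []]].
Qed.

Lemma integral_ramp (a s : R) : 0 <= s ->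
  (\int[lebesgue_measure]_(x in `[a, (a + s)%R]) (a + s - x)%R%:E = (s ^+ 2 /
    2)%R%:E)%E.
Proof.
rewrite le_eqVlt => /predU1P[<-|s0].
  by rewrite addr0 set_itv1 integral_set1 expr0n mul0r.
pose F (x : R) : R := - ((a + s - x) ^+ 2 / 2).
have dF (x : R) : is_derive x 1 F (a + s - x).
  rewrite /F; apply: is_derive_eq.
  by rewrite /GRing.scale/= !mulr0 !add0r !mul1r; lra.
have cF (x : R) : {for x, continuous F}.
  by apply: differentiable_continuous; apply/derivable1_diffP;
    exact: (@ex_derive _ _ _ _ _ _ _ (dF x)).
rewrite (@continuous_FTC2 R (fun x => a + s - x) F).
- by rewrite -EFinB /F; congr (_%:E); field.
- by rewrite ltrDl.
- apply: continuous_subspaceT => x; apply: cvgB; [exact: cvg_cst|exact: cvg_id].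
- split.
  + by move=> x _; exact: (@ex_derive _ _ _ _ _ _ _ (dF x)).
  + by apply: cvg_at_right_filter; exact: cF.
  + by apply: cvg_at_left_filter; exact: cF.
- by move=> x _; rewrite derive1E; exact: (@derive_val _ _ _ _ _ _ _ (dF x)).
Qed.

(** Slicing at a fixed first coordinate [x] in [[c3, c3 + s]] gives an interval of length
    [c3 + s - x]. *)
Lemma vol_coordinate_triangle (c1 c2 c3 : R) : c1 + c2 + c3 <= 1 ->
  vol (coordinate_triangle true true true c1 c2 c3) = ((1 - (c1 + c2 + c3)) ^+
    2 / 2)%:E.
Proof.
move=> c; set s := 1 - (c1 + c2 + c3); have s0 : 0 <= s by rewrite subr_ge0.
rewrite -(integral_ramp c3 s0) integral_mkcond /vol.
rewrite -[LHS]/(\int[lebesgue_measure]_x (lebesgue_measure \o xsection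
  (coordinate_triangle true true true c1 c2 c3)) x)%E.
apply: eq_integral => x _; rewrite /= patchE.
have sE : s = 1 - (c1 + c2 + c3) by [].
case: ifPn => [|/negP] xI.
  move: xI; rewrite inE/= in_itv/= => /andP[x1 x2].
  rewrite (_ : xsection _ _ = `[c2, c2 + (c3 + s - x)]%classic).
    rewrite lebesgue_measure_itv/= lte_fin ltrDl; case: ltP => h.
      by rewrite -EFinB addrC addKr.
    by congr (_%:E); lra.
  apply/seteqP; split => y; rewrite /xsection/= inE/= in_itv/=.
    by move=> [/= ? ? ?]; apply/andP; split; lra.
  by move=> /andP[? ?]; split => /=; lra.
rewrite (_ : xsection _ _ = set0) ?measure0//.
apply/seteqP; split => y //; rewrite /xsection/= inE/= => -[/= ? ? ?].
apply: xI; rewrite inE/= in_itv/=; apply/andP; split; lra.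
Qed.

Lemma vol_coordinate_triangle_max (c1 c2 c3 : R) :
  vol (coordinate_triangle true true true c1 c2 c3) =
    ((Num.max 0 (1 - (c1 + c2 + c3))) ^+ 2 / 2)%:E.
Proof.
have [h|h] := leP 0 (1 - (c1 + c2 + c3)).
  by rewrite vol_coordinate_triangle// -subr_ge0.
rewrite expr0n mul0r (_ : coordinate_triangle _ _ _ _ _ _ = set0).
  by rewrite /vol measure0.
by apply/seteqP; split => p //= [/= ? ? ?]; lra.
Qed.

Lemma le_vol (A B : set (R * R)) :
  measurable (A : set T2) -> measurable (B : set T2) -> A `<=` B ->
    (vol A <= vol B)%E.
Proof. by move=> mA mB AB; apply: le_measure; rewrite ?inE. Qed.

Lemma vol_setDI (A B : set (R * R)) :
  measurable (A : set T2) -> measurable (B : set T2) ->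
  (vol A = vol (A `\` B) + vol (A `&` B))%E.
Proof. by move=> mA mB; exact: measureDI. Qed.

End Volume.

(** * The discrepancy of the rotated lattice *)

(** The terms of [s2] left after removing [s1] each lie in [[0, 1]]. This compares a selection of
    lattice points with all of them, and all of them with a padded list, which may have
    repetitions. *)
Lemma sum_subset_seq (R : realType) (T : eqType) (f : T -> R) (s1 s2 : seq T) :
    (forall x, 0 <= f x <= 1) -> uniq s1 -> {subset s1 <= s2} ->
  0 <= \sum_(x <- s2) f x - \sum_(x <- s1) f x <= (size s2)%:R - (size s1)%:R.
Proof.
move=> f01; elim: s1 s2 => [|x s1 IH] s2 /=.
  rewrite big_nil !subr0 => _ _; rewrite sumr_ge0/=; last first.
    by move=> x _; case/andP: (f01 x).
  rewrite -sum1_size natr_sum; apply: ler_sum => x _.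
  by case/andP: (f01 x).
move=> /andP[xs1 us1] sub; have xs2 : x \in s2 by rewrite sub ?mem_head.
have /(IH (rem x s2) us1) : {subset s1 <= rem x s2}.
  move=> y ys1; have : y \in s2 by rewrite sub// inE ys1 orbT.
  rewrite (perm_mem (perm_to_rem xs2)) inE => /predU1P[yx|//].
  by rewrite -yx ys1 in xs1.
rewrite (perm_big _ (perm_to_rem xs2))/= !big_cons (perm_size (perm_to_rem
  xs2))/=.
by rewrite -!natr1 => /andP[? ?]; apply/andP; split; lra.
Qed.

Lemma card_le_set_seq (T : choiceType) (s : seq T) (n : nat) : uniq s ->
  (`I_n #<= [set` s])%card = (n <= size s)%N.
Proof.
move=> us; pose F := seq_fset tt s.
have FE : [set` F] = [set` s].
  by apply/seteqP; split => x /=; rewrite seq_fsetE.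
have /card_eq_fsetP : size (enum_fset F) = size s.
  by rewrite size_seq_fset undup_id.
rewrite FE => /card_eqPle[h1 h2]; apply/idP/idP => h.
  by rewrite -card_le_II (card_le_trans h).
by apply: card_le_trans h2; rewrite card_le_II.
Qed.

Lemma scale_pairE (R : realType) (a x y : R) :
  a *: ((x, y) : R * R) = (a * x, a * y).
Proof. by []. Qed.

Lemma add_pairE (R : realType) (x y x' y' : R) :
  (x, y) + (x', y') = (x + x', y + y') :> R * R.
Proof. by []. Qed.

Section Discrepancy.
Variables (R : realType) (alpha : R).
Implicit Types (r : R) (M : nat) (X Y : set (R * R)).
Local Notation T2 := (measurableTypeR R * measurableTypeR R)%type.

(** The offset [M] lets natural indices up to [2 * M] cover the integers from [-M] to [M]; the index
    [i] belongs to the second lattice coordinate. *)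
Definition lattice_point r M (i j : nat) : R * R :=
  rotation alpha (r^-1 *: ((j%:R - M%:R, i%:R - M%:R) : R * R)).

Definition point_count r M X : R :=
  \sum_(i < (2 * M).+1) \sum_(j < (2 * M).+1) \1_X (lattice_point r M i j).

(** A cell of the lattice has area [r ^- 2], so [r ^+ 2] is the density of points; the difference is
    not normalised by the number of points. *)
Definition lattice_discrepancy r M X : R :=
  r ^+ 2 * fine (vol X) - point_count r M X.

Lemma right_triangleE :
  right_triangle R = coordinate_triangle true true true 0 0 0.
Proof.
apply/seteqP; split => p /=.
  move=> [w1 [w2 [w3 [w10 w20 w30 w ->]]]].
  by rewrite !scale_pairE !add_pairE; split => /=; lra.
move=> [/= h1 h2 h3]; exists (1 - p.1 - p.2), p.2, p.1; split => //;
  first by lra.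
rewrite !scale_pairE !add_pairE [LHS]surjective_pairing.
congr pair; rewrite /=; lra.
Qed.

(** Rotating back writes [u] and [v] as [r] times combinations of [x] and [y] with coefficients at
    most 1 in absolute value, and [x + y <= 1] with both nonnegative. This places the lattice points
    of the triangle in the index box once [r <= M]. *)
Lemma rotation_right_triangle_bound r (u v : R) : 0 < r ->
  right_triangle R (rotation alpha (r^-1 *: ((u, v) : R * R))) ->
  `|u| <= r /\ `|v| <= r.
Proof.
rewrite scale_pairE right_triangleE => r0 [] /=.
set c := cos alpha; set s := sin alpha.
have cs1 : c ^+ 2 + s ^+ 2 = 1 := cos2Dsin2 alpha.
set x := c * _ - _; set y := s * _ + _ => h1 y0 x0.
have le1 (a b : R) : a ^+ 2 + b ^+ 2 = 1 -> `|r * (a * x + b * y)| <= r.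
  move=> ab; have a1 : `|a| <= 1.
    by rewrite -(@expr_le1 _ 2)// real_normK ?num_real// -ab lerDl sqr_ge0.
  have b1 : `|b| <= 1.
    by rewrite -(@expr_le1 _ 2)// real_normK ?num_real// -ab lerDr sqr_ge0.
  rewrite normrM gtr0_norm// ler_piMr ?(ltW r0)//.
  apply: le_trans (ler_normD _ _) _; rewrite (normrM a) (normrM b).
  rewrite (ger0_norm x0) (ger0_norm y0).
  by apply: le_trans (lerD (ler_piMl x0 a1) (ler_piMl y0 b1)) _; lra.
have rV : r * r^-1 = 1 by rewrite divff// gt_eqF.
have uE : u = r * (c * x + s * y).
  transitivity ((c ^+ 2 + s ^+ 2) * (r * r^-1) * u);
    first by rewrite cs1 rV !mul1r.
  by rewrite /x /y; ring.
have vE : v = r * (- s * x + c * y).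
  transitivity ((c ^+ 2 + s ^+ 2) * (r * r^-1) * v);
    first by rewrite cs1 rV !mul1r.
  by rewrite /x /y; ring.
split; first by rewrite uE le1.
by rewrite vE le1// sqrrN addrC.
Qed.

(** In the lattice indices the barycentric coordinates, scaled by [r], are linear forms with slopes
    [(1 - t) / (1 + t)], [1 / t] and [- t] for [t = tan alpha], up to constants. Their pairwise
    determinants are [c ^+ 2 + s ^+ 2 = 1] up to sign, so [triangle_count] applies with [E = 1]. *)
Lemma closed_triangle_discrepancy : quadratic_irrational (tan alpha) ->
  exists2 K : R, 0 < K & forall r M (c1 c2 c3 : R), 0 < r -> r <= M%:R ->
    0 <= c1 -> 0 <= c2 -> 0 <= c3 ->
  `|lattice_discrepancy r M (coordinate_triangle true true true c1 c2 c3)|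
     <= K * (1 + ln (2 * M).+1%:R).
Proof.
move=> /quadratic_irrational_badly_approximable bt.
set t := tan alpha in bt; pose c := cos alpha; pose s := sin alpha.
have irr (p q : int) : (p != 0) || (q != 0) -> q%:~R * t - p%:~R != 0.
  move=> pq; have [k k0 /(_ p q pq)] := bt.
  by apply: contraTneq => ->; rewrite normr0 mul0r -ltNge.
have t0 : t != 0 by have := irr 0 1 isT; rewrite mul1r subr0.
have t1 : t - 1 != 0 by have := irr 1 1 isT; rewrite mul1r.
have tN1 : t + 1 != 0 by have := irr (-1) 1 isT; rewrite mul1r mulrN1z opprK.
(* Where the cosine vanishes, [tan] has the default value 0, which [t0] excludes. *)
have c0 : c != 0 by apply: contraNneq t0 => c0;
  rewrite /t /tan -/c c0 invr0 mulr0.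
have sE : s = t * c by rewrite /t /tan -/c -/s mulfVK.
have s0 : s != 0 by rewrite sE mulf_neq0.
have sc0 : s + c != 0 by rewrite sE -[X in _ + X]mul1r -mulrDl mulf_neq0.
have cs1 : c ^+ 2 + s ^+ 2 = 1 := cos2Dsin2 alpha.
have b1 : badly_approximable ((s - c) / - (s + c)).
  have := @badly_approximable_moebius _ _ (-1) 1 1 1 isT bt.
  rewrite mulrN1z mul1r mulN1r sE; congr badly_approximable.
  by field; rewrite tN1 -sE sc0.
have b2 : badly_approximable (c / s).
  have := @badly_approximable_moebius _ _ 0 1 1 0 isT bt.
  rewrite mul0r add0r mul1r addr0 sE; congr badly_approximable.
  by field; rewrite c0 t0.
have b3 : badly_approximable (- s / c).
  by rewrite sE mulNr mulfK//; exact: badly_approximableN.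
have [K K0 KP] : triangle_count_bound 1 (- (s + c)) (s - c) s c c (- s).
  apply: triangle_count => //; rewrite ?oppr_eq0//; try by ring.
  by rewrite (_ : _ - _ = c ^+ 2 + s ^+ 2); [rewrite cs1 normr1|ring].
exists K => // r M c1 c2 c3 r0 rM c10 c20 c30.
have rV : r * r^-1 = 1 by rewrite divff// gt_eqF.
set W := (2 * M).+1.
have WE : W%:R - 1 = 2 * M%:R :> R by rewrite /W -natr1 natrM; ring.
rewrite /lattice_discrepancy vol_coordinate_triangle_max /=.
have [h|h] := leP 0 (1 - (c1 + c2 + c3)); last first.
  rewrite expr0n !mul0r mulr0 /point_count sub0r normrN big1 ?normr0.
    by rewrite mulr_ge0 ?(ltW K0)// addr_ge0// ln_ge0// ler1n.
  move=> i _; rewrite big1// => j _; rewrite indicE memNset// => -[/= ? ? ?];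
    lra.
(* The thresholds absorb the index shift by [M] and the constant 1 of the first coordinate; the
   multiples of [M] cancel in the sum. *)
pose g1 := r * (c1 - 1) + (- (s + c) + (s - c)) * M%:R.
pose g2 := r * c2 + (s + c) * M%:R.
pose g3 := r * c3 + (c - s) * M%:R.
have gE : g1 + g2 + g3 = - (r * (1 - (c1 + c2 + c3))) by rewrite /g1 /g2 /g3;
  ring.
pose px (x y : R) := r^-1 * (c * (y - M%:R) - s * (x - M%:R)).
pose py (x y : R) := r^-1 * (s * (y - M%:R) + c * (x - M%:R)).
have rpx x y : r * px x y = c * (y - M%:R) - s * (x - M%:R) by rewrite /px
  mulrA rV mul1r.
have rpy x y : r * py x y = s * (y - M%:R) + c * (x - M%:R) by rewrite /py
  mulrA rV mul1r.
have e1 x y : (g1 <= - (s + c) * y + (s - c) * x) = (c1 <= 1 - px x y - py x y).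
  rewrite -[RHS](ler_pM2l r0) !mulrBr rpx rpy /g1; apply/idP/idP; lra.
have e2 x y : (g2 <= s * y + c * x) = (c2 <= py x y).
  rewrite -[RHS](ler_pM2l r0) rpy /g2; apply/idP/idP; lra.
have e3 x y : (g3 <= c * y + - s * x) = (c3 <= px x y).
  rewrite -[RHS](ler_pM2l r0) rpx /g3; apply/idP/idP; lra.
have lpE (i j : nat) : lattice_point r M i j = (px i%:R j%:R, py i%:R j%:R).
  by rewrite /lattice_point scale_pairE /rotation /= /px /py -/c -/s;
    congr pair; ring.
have box x y : g1 <= - (s + c) * y + (s - c) * x -> g2 <= s * y + c * x ->
    g3 <= c * y + - s * x -> 0 <= x <= W%:R - 1 /\ 0 <= y <= W%:R - 1.
  rewrite e1 e2 e3 WE => h1 h2 h3.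
  have bd (u : R) : `|u - M%:R| <= r -> 0 <= u <= 2 * M%:R.
    move=> /le_trans/(_ rM); rewrite ler_norml => /andP[? ?].
    by apply/andP; split; lra.
  have [] := @rotation_right_triangle_bound r (y - M%:R) (x - M%:R) r0.
    rewrite right_triangleE scale_pairE /rotation /= -/c -/s.
    rewrite !(mulrCA _ r^-1) -!mulrBr -!mulrDr -/(px x y) -/(py x y).
    by split => /=; [exact: le_trans h1|exact: le_trans h2|exact: le_trans h3].
  by move=> yM xM; split; exact: bd.
have := KP W g1 g2 g3 isT.
rewrite gE oppr_le0 sqrrN exprMn => /(_ (mulr_ge0 (ltW r0) h) box).
rewrite mulr1 distrC -[_ * _ / 2]mulrA.
rewrite [X in `|_ - X| <= _ ->
  _](_ : _ = point_count r M (coordinate_triangle true true true c1 c2 c3))//.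
apply: eq_bigr => i _; apply: eq_bigr => j _.
rewrite e1 e2 e3 lpE indicE; congr ((nat_of_bool _)%:R); apply/idP/idP.
  by move=> /and3P[? ? ?]; rewrite inE/=; split.
by rewrite inE/= => -[? ? ?]; apply/and3P; split.
Qed.

Lemma vol_triangle_fin (b1 b2 b3 : bool) (c1 c2 c3 : R) :
  vol (coordinate_triangle b1 b2 b3 c1 c2 c3) \is a fin_num.
Proof.
rewrite ge0_fin_numE ?measure_ge0//;
  apply: (@le_lt_trans _ _ (vol (coordinate_triangle true true true c1 c2 c3))).
  apply: le_vol; [exact: measurable_coordinate_triangle|exact:
    measurable_coordinate_triangle|].
  by move=> p [/= h1 h2 h3]; split => /=;
    [exact: lteifW h1|exact: lteifW h2|exact: lteifW h3].
by rewrite vol_coordinate_triangle_max ltry.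
Qed.

Lemma le_point_count r M X Y : X `<=` Y ->
  point_count r M X <= point_count r M Y.
Proof.
move=> XY; apply: ler_sum => i _; apply: ler_sum => j _;
  rewrite !indicE ler_nat.
by case: (boolP (_ \in X)) => //; rewrite inE => /XY; rewrite -in_setE => ->.
Qed.

(* A half-open triangle lies between the closed one and a closed one shrunk so
   little that the area lost accounts for at most one lattice point. *)
Lemma half_open_triangle_discrepancy r M (L : R) (b1 b2 b3 : bool) (c1 c2 c3 :
  R) :
    0 < r -> 0 <= c1 -> 0 <= c2 -> 0 <= c3 ->
    (forall d1 d2 d3 : R, 0 <= d1 -> 0 <= d2 -> 0 <= d3 ->
      `|lattice_discrepancy r M (coordinate_triangle true true true d1 d2 d3)|
        <= L) ->
  `|lattice_discrepancy r M (coordinate_triangle b1 b2 b3 c1 c2 c3)| <= L + 1.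
Proof.
move=> r0 c10 c20 c30 HL.
have r20 : 0 < r ^+ 2 by rewrite exprn_gt0.
(* Moving each of the three sides inwards by [d] costs area at most [3 d], which is one point at
   density [r ^+ 2]. *)
pose d : R := (3 * r ^+ 2)^-1.
have d0 : 0 < d by rewrite invr_gt0 mulr_gt0.
have dE : r ^+ 2 * (3 * d) = 1 by rewrite mulrCA mulrA divff// gt_eqF//
  mulr_gt0.
have clip (u e : R) : 0 < e -> u <= 1 ->
    Num.max 0 u ^+ 2 / 2 <= Num.max 0 (u - e) ^+ 2 / 2 + e.
  clear => e0 u1; have [h|h] := leP 0 u; have [k|k] := leP 0 (u - e).
  - have := sqr_ge0 e; have : e * u <= e by rewrite ler_piMr// ltW.
    rewrite !expr2; lra.
  - have : 0 <= u * (e - u) by rewrite mulr_ge0//; lra.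
    have : e * u <= e by rewrite ler_piMr// ltW.
    rewrite !expr2; lra.
  - exfalso; lra.
  - rewrite !expr2; lra.
set T := coordinate_triangle b1 b2 b3 c1 c2 c3.
pose T1 := coordinate_triangle true true true c1 c2 c3.
pose T0 := coordinate_triangle true true true (c1 + d) (c2 + d) (c3 + d).
have TT1 : T `<=` T1 by move=> p [/= h1 h2 h3]; split => /=;
  [exact: lteifW h1|exact: lteifW h2|exact: lteifW h3].
have TT2 : T0 `<=` T.
  have lt (b : bool) (u v : R) : u + d <= v -> u < v ?<= if b.
    by move=> h; apply: lteifS; apply: lt_le_trans h; rewrite ltrDl.
  by move=> p [/= h1 h2 h3]; split => /=; apply: lt.
have v1 : fine (vol T) <= fine (vol T1).
  rewrite fine_le ?vol_triangle_fin//; apply: le_vol => //;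
    exact: measurable_coordinate_triangle.
have v2 : fine (vol T0) <= fine (vol T).
  rewrite fine_le ?vol_triangle_fin//; apply: le_vol => //;
    exact: measurable_coordinate_triangle.
have v3 : fine (vol T1) <= fine (vol T0) + 3 * d.
  rewrite /T1 /T0 !vol_coordinate_triangle_max/=.
  rewrite (_ : 1 - (c1 + d + _ + _) = 1 - (c1 + c2 + c3) - 3 * d); last by ring.
  by apply: clip; [rewrite mulr_gt0|rewrite gerBl !addr_ge0].
have p1 := le_point_count r M TT1; have p2 := le_point_count r M TT2.
have w1 : r ^+ 2 * fine (vol T) <= r ^+ 2 * fine (vol T1) by rewrite ler_pM2l.
have w2 : r ^+ 2 * fine (vol T0) <= r ^+ 2 * fine (vol T) by rewrite ler_pM2l.
have w3 : r ^+ 2 * fine (vol T1) <= r ^+ 2 * fine (vol T0) + 1.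
  by rewrite -dE -mulrDr ler_pM2l.
have squeeze (v u w n m k : R) : n <= m -> k <= n -> v <= u -> w <= v ->
    u <= w + 1 -> `|u - m| <= L -> `|w - k| <= L -> `|v - n| <= L + 1.
  clear; rewrite !ler_norml => ? ? ? ? ? /andP[? ?] /andP[? ?].
  by apply/andP; split; lra.
apply: squeeze p1 p2 w1 w2 w3 _ _; first exact: HL.
by apply: HL; rewrite addr_ge0// ltW.
Qed.

(** * Cutting corners off the triangle *)

Lemma lattice_discrepancy_setDI r M X Y :
    measurable (X : set T2) -> measurable (Y : set T2) -> vol X \is a fin_num ->
  lattice_discrepancy r M X =
    lattice_discrepancy r M (X `\` Y) + lattice_discrepancy r M (X `&` Y).
Proof.
move=> mX mY fX; have volE := vol_setDI mX mY.
have fin : vol (X `\` Y) \is a fin_num /\ vol (X `&` Y) \is a fin_num.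
  by move: fX; rewrite volE fin_numD => /andP[].
case: fin => f1 f2.
rewrite /lattice_discrepancy volE fineD// /point_count.
rewrite [X in _ - X = _](_ : _ = point_count r M (X `\` Y) + point_count r M (X
  `&` Y)).
  by rewrite /point_count; ring.
rewrite /point_count -big_split; apply: eq_bigr => i _; rewrite -big_split;
  apply: eq_bigr => j _.
rewrite !indicE in_setD in_setI /=.
by case: (_ \in X); case: (_ \in Y); rewrite /= ?addr0 ?add0r.
Qed.

(** Inclusion-exclusion: the intersection is [X] minus [X \ Y1] minus [X \ Y2] plus the part of [X]
    outside both, and the discrepancy is additive. *)
Lemma lattice_discrepancy_two_cuts r M X Y1 Y2 (L : R) :
    measurable (X : set T2) -> measurable (Y1 : set T2) ->
      measurable (Y2 : set T2) ->
    vol X \is a fin_num ->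
    `|lattice_discrepancy r M X| <= L ->
    `|lattice_discrepancy r M (X `\` Y1)| <= L ->
    `|lattice_discrepancy r M (X `\` Y2)| <= L ->
    `|lattice_discrepancy r M ((X `\` Y2) `\` Y1)| <= L ->
  `|lattice_discrepancy r M (X `&` Y1 `&` Y2)| <= 4 * L.
Proof.
move=> mX m1 m2 fX.
have fD Y : measurable (Y : set T2) ->
  vol (X `\` Y) \is a fin_num /\ vol (X `&` Y) \is a fin_num.
  by move=> mY; move: fX; rewrite (vol_setDI mX mY) fin_numD => /andP[].
have [_ f1] := fD _ m1; have [f2 _] := fD _ m2.
rewrite (lattice_discrepancy_setDI r M mX m1 fX).
rewrite (lattice_discrepancy_setDI r M (measurableI _ _ mX m1) m2 f1).
rewrite (lattice_discrepancy_setDI r M (measurableD mX m2) m1 f2).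
rewrite [(X `&` Y1) `\` Y2](_ : _ = (X `\` Y2) `&` Y1); last first.
  by apply/seteqP; split => p /=; tauto.
rewrite !ler_norml => /andP[? ?] /andP[? ?] /andP[? ?] /andP[? ?].
by apply/andP; split; lra.
Qed.

Lemma parallelogramE (v1 v2 u1 u2 w1 w2 a b : R) :
  parallelogram (v1, v2) (u1, u2) (w1, w2) a b =
    [set p | exists s t : R, [/\ 0 <= s <= a, 0 <= t <= b,
      p.1 = v1 + s * (u1 - v1) + t * (w1 - v1) &
      p.2 = v2 + s * (u2 - v2) + t * (w2 - v2)]].
Proof.
apply/seteqP; split => p /= [s [t [sa tb]]].
  by move=> ->; exists s, t.
by case: p => x y /= -> ->; exists s, t.
Qed.

(** The parameters of a point in a parallelogram are its barycentric coordinates at the two other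
    vertices. Within the triangle, the parallelogram therefore caps these two coordinates by [a] and
    [b], and the points violating one or both caps form half-open homothetic triangles. *)
Lemma parallelograms_discrepancy r M (L : R) (S : set (R * R)) :
    0 < r ->
    (forall b1 b2 b3 (d1 d2 d3 : R), 0 <= d1 -> 0 <= d2 -> 0 <= d3 ->
      `|lattice_discrepancy r M (coordinate_triangle b1 b2 b3 d1 d2 d3)| <= L)
        ->
    parallelograms (0, 0) (0, 1) (1, 0) S ->
  `|lattice_discrepancy r M (S `&` right_triangle R)| <= 4 * L.
Proof.
move=> r0 HL.
have [m1 m2 m3] := measurable_coordinates R.
pose H1 (a : R) : set T2 := [set p | 1 - p.1 - p.2 <= a].
pose H2 (a : R) : set T2 := [set p | p.2 <= a].
pose H3 (a : R) : set T2 := [set p | p.1 <= a].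
have mle (f : T2 -> R) (a : R) : measurable_fun setT f ->
  measurable ([set p | f p <= a] : set T2).
  move=> mf; rewrite [X in measurable X](_ : _ = ~` [set p | a < f p ?<= if
    false]).
    by apply: measurableC; exact: measurable_halfplane.
  by apply/seteqP; split => p /=; rewrite leNgt => /negP.
have mH1 a : measurable (H1 a) by exact: mle.
have mH2 a : measurable (H2 a) by exact: mle.
have mH3 a : measurable (H3 a) by exact: mle.
have mT := measurable_coordinate_triangle (R := R).
have D0 : coordinate_triangle true true true 0 0 0 = right_triangle R by
  rewrite right_triangleE.
have D1 a : 0 < a -> right_triangle R `\` H1 a = coordinate_triangle false true
  true a 0 0.
  move=> a0; rewrite right_triangleE; apply/seteqP; split => p /=.
    by move=> [[/= ? ? ?] /negP]; rewrite -ltNge => ?; split.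
  by move=> [/= ? ? ?]; split; [split => /=; lra|apply/negP; rewrite -ltNge].
have D2 a : 0 < a -> right_triangle R `\` H2 a = coordinate_triangle true false
  true 0 a 0.
  move=> a0; rewrite right_triangleE; apply/seteqP; split => p /=.
    by move=> [[/= ? ? ?] /negP]; rewrite -ltNge => ?; split.
  by move=> [/= ? ? ?]; split; [split => /=; lra|apply/negP; rewrite -ltNge].
have D3 a : 0 < a -> right_triangle R `\` H3 a = coordinate_triangle true true
  false 0 0 a.
  move=> a0; rewrite right_triangleE; apply/seteqP; split => p /=.
    by move=> [[/= ? ? ?] /negP]; rewrite -ltNge => ?; split.
  by move=> [/= ? ? ?]; split; [split => /=; lra|apply/negP; rewrite -ltNge].
have mO : measurable (right_triangle R : set T2) by rewrite right_triangleE.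
have fO : vol (right_triangle R) \is a fin_num by rewrite right_triangleE
  vol_triangle_fin.
have cut Y1 Y2 := @lattice_discrepancy_two_cuts r M (right_triangle R) Y1 Y2 L
  mO.
have eO : `|lattice_discrepancy r M (right_triangle R)| <= L by rewrite -D0 HL.
have two (a b : R) : 0 < a -> 0 < b ->
  [/\ `|lattice_discrepancy r M ((right_triangle R `\` H3 b) `\` H2 a)| <= L,
      `|lattice_discrepancy r M ((right_triangle R `\` H1 b) `\` H3 a)| <= L &
      `|lattice_discrepancy r M ((right_triangle R `\` H2 b) `\` H1 a)| <= L].
  move=> a0 b0; split.
  - rewrite D3// (_ : _ `\` _ = coordinate_triangle true false false 0 a b) ?HL
      ?(ltW a0) ?(ltW b0)//.
    apply/seteqP; split => p /=.
      by move=> [[/= ? ? ?] /negP]; rewrite -ltNge => ?; split.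
    by move=> [/= ? ? ?]; split; [split => /=; lra|apply/negP; rewrite -ltNge].
  - rewrite D1// (_ : _ `\` _ = coordinate_triangle false true false b 0 a) ?HL
      ?(ltW a0) ?(ltW b0)//.
    apply/seteqP; split => p /=.
      by move=> [[/= ? ? ?] /negP]; rewrite -ltNge => ?; split.
    by move=> [/= ? ? ?]; split; [split => /=; lra|apply/negP; rewrite -ltNge].
  - rewrite D2// (_ : _ `\` _ = coordinate_triangle false false true a b 0) ?HL
      ?(ltW a0) ?(ltW b0)//.
    apply/seteqP; split => p /=.
      by move=> [[/= ? ? ?] /negP]; rewrite -ltNge => ?; split.
    by move=> [/= ? ? ?]; split; [split => /=; lra|apply/negP; rewrite -ltNge].
case=> [[|]|] [a [b [/andP[a0 _] /andP[b0 _] ->]]];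
  have [t1 t2 t3] := two a b a0 b0.
- rewrite (_ : _ `&` _ = right_triangle R `&` H2 a `&` H3 b).
    by apply: cut => //; rewrite ?D2 ?D3// HL// ltW.
  rewrite parallelogramE right_triangleE; apply/seteqP; split => -[x y] /=.
    move=> [[s [t [/andP[? ?] /andP[? ?]]]]].
    move=> -> -> h; split; [split => //|]; rewrite /H2 /H3 /=; lra.
  move=> [[h h2] h3]; split => //; exists y, x; case: h => /= ? ? ?.
  by split; rewrite /H1 /H2 /H3 /= in h2 h3 *; try (apply/andP; split); lra.
- rewrite (_ : _ `&` _ = right_triangle R `&` H3 a `&` H1 b).
    by apply: cut => //; rewrite ?D1 ?D3// HL// ltW.
  rewrite parallelogramE right_triangleE; apply/seteqP; split => -[x y] /=.
    move=> [[s [t [/andP[? ?] /andP[? ?]]]]].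
    move=> -> -> h; split; [split => //|]; rewrite /H1 /H3 /=; lra.
  move=> [[h h2] h3]; split => //; exists x, (1 - x - y); case: h => /= ? ? ?.
  by split; rewrite /H1 /H2 /H3 /= in h2 h3 *; try (apply/andP; split); lra.
- rewrite (_ : _ `&` _ = right_triangle R `&` H1 a `&` H2 b).
    by apply: cut => //; rewrite ?D1 ?D2// HL// ltW.
  rewrite parallelogramE right_triangleE; apply/seteqP; split => -[x y] /=.
    move=> [[s [t [/andP[? ?] /andP[? ?]]]]].
    move=> -> -> h; split; [split => //|]; rewrite /H1 /H2 /=; lra.
  move=> [[h h2] h3]; split => //; exists (1 - x - y), y; case: h => /= ? ? ?.
  by split; rewrite /H1 /H2 /H3 /= in h2 h3 *; try (apply/andP; split); lra.
Qed.

(** * The lattice points of the triangle as a list *)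

Definition triangle_points r M : seq (R * R) :=
  [seq p <- [seq lattice_point r M ij.1 ij.2
            | ij : 'I_(2 * M).+1 * 'I_(2 * M).+1 <- enum {: 'I_(2 * M).+1 *
              'I_(2 * M).+1}]
  | p \in right_triangle R].

Lemma rotation_inj : injective (rotation alpha : R * R -> R * R).
Proof.
move=> [x y] [x' y'] [] /= e1 e2.
have cs1 : cos alpha ^+ 2 + sin alpha ^+ 2 = 1 := cos2Dsin2 alpha.
congr pair.
  rewrite -[x]mul1r -[x']mul1r -cs1.
  transitivity (cos alpha * (cos alpha * x - sin alpha * y) + sin alpha * (sin
    alpha * x + cos alpha * y)); first by ring.
  by rewrite e1 e2; ring.
rewrite -[y]mul1r -[y']mul1r -cs1.
transitivity (cos alpha * (sin alpha * x + cos alpha * y) - sin alpha * (cos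
  alpha * x - sin alpha * y)); first by ring.
by rewrite e1 e2; ring.
Qed.

Lemma uniq_triangle_points r M : 0 < r -> uniq (triangle_points r M).
Proof.
move=> r0; rewrite filter_uniq// map_inj_uniq ?enum_uniq// =>
  -[i j] [i' j'] /= /rotation_inj.
rewrite !scale_pairE => -[] /(mulfI (invr_neq0 (lt0r_neq0 r0)))/addIr/eqP.
rewrite eqr_nat => /eqP/val_inj ->
  /(mulfI (invr_neq0 (lt0r_neq0 r0)))/addIr/eqP.
by rewrite eqr_nat => /eqP/val_inj ->.
Qed.

Lemma sum_triangle_points r M X :
  \sum_(p <- triangle_points r M) \1_X p = point_count r M (X `&`
    right_triangle R).
Proof.
rewrite big_filter big_map big_enum_cond big_mkcond /point_count pair_bigA/=.
apply: eq_bigr => -[i j] _ /=; rewrite !indicE in_setI.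
by case: (_ \in right_triangle R); rewrite ?andbT ?andbF.
Qed.

Lemma size_triangle_points r M :
  (size (triangle_points r M))%:R = point_count r M (right_triangle R).
Proof.
rewrite -[right_triangle R]setTI -sum_triangle_points -sum1_size natr_sum.
by apply: eq_bigr => p _; rewrite indicT.
Qed.

Lemma triangle_pointsE (N M : nat) :
    0 < Num.sqrt (2 * N%:R : R) -> Num.sqrt (2 * N%:R : R) <= M%:R ->
  [set` triangle_points (Num.sqrt (2 * N%:R)) M] = rotated_lattice_points alpha
    N.
Proof.
set r : R := Num.sqrt _ => r0 rM; apply/seteqP; split => p /=.
  rewrite mem_filter => /andP[pO /mapP[[i j] _ pE]]; rewrite {p}pE in pO *.
  split; last exact: set_mem pO.
  exists (r^-1 *: ((j%:R - M%:R, i%:R - M%:R) : R * R)) => //.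
  by exists (j%:Z - M%:Z), (i%:Z - M%:Z); rewrite !intrB.
move=> [[q [m [n ->]] <-] pO].
have [mr nr] := rotation_right_triangle_bound r0 pO.
have idx (k : int) : `|k%:~R : R| <= r ->
  exists i : 'I_(2 * M).+1, k%:~R = i%:R - M%:R :> R.
  move=> /le_trans/(_ rM);
    rewrite ler_norml -[M%:R]/(M%:Z%:~R) -intrN !ler_int => /andP[k1 k2].
  have lt : (`|(k + M%:Z)%R| < (2 * M).+1)%N by clear -k1 k2; lia.
  exists (Ordinal lt); rewrite /= natr_absz ger0_norm; last by clear -k1; lia.
  by rewrite intrD intrN addrK.
have [j jE] := idx _ mr; have [i iE] := idx _ nr.
rewrite mem_filter; apply/andP; split; first by rewrite inE.
by apply/mapP; exists (i, j); rewrite ?mem_enum//= /lattice_point -jE -iE.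
Qed.

End Discrepancy.

(** * Logarithmic estimates and the size of the index box *)

Section Bounds.
Variable R : realType.

(** From [ln (1 - 1/2) <= - 1/2]; this absorbs additive constants into multiples of [ln n]. *)
Lemma half_le_ln (n : nat) : (1 < n)%N -> 2^-1 <= ln n%:R :> R.
Proof.
move=> n1; apply: (@le_trans _ _ (ln 2)); last first.
  by rewrite ler_ln ?posrE ?ltr0n ?(ltn_trans _ n1)// ler_nat.
have := @le_ln1Dx R (- 2^-1); rewrite (_ : 1 + - 2^-1 = 2^-1 :> R); last by lra.
by rewrite lnV ?posrE// lerN2; apply; lra.
Qed.

(** For [N >= 2] one has [2 N <= N ^ 2] and [2 N + 1 <= 4 N <= N ^ 3]. Hence [M = N] is an
    admissible box size for [r = sqrt (2 N)]. *)
Lemma box_bound (N : nat) : (1 < N)%N ->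
  Num.sqrt (2 * N%:R) <= N%:R :> R /\ ln (2 * N).+1%:R <= 3 * ln N%:R :> R.
Proof.
move=> N1; have N2 : 2 <= N%:R :> R by rewrite ler_nat.
split.
  rewrite -(@ler_pXn2r _ 2)// ?nnegrE// ?sqrtr_ge0// sqr_sqrtr ?mulr_ge0//
    expr2.
  by rewrite ler_pM2r// (lt_le_trans _ N2).
rewrite mulr_natl -lnXn ?ltr0n ?(ltn_trans _ N1)//.
rewrite ler_ln ?posrE ?ltr0n// ?exprn_gt0 ?ltr0n ?(ltn_trans _ N1)//.
rewrite -natrX ler_nat.
have : (4 * N <= N ^ 3)%N by rewrite 2!expnSr expn1 leq_mul// (leq_mul N1 N1).
by clear -N1; lia.
Qed.

End Bounds.

Unset Implicit Arguments.
Set Strict Implicit.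

Theorem theorem5 (R : realType) (alpha : R) (alpha_range : 0 < alpha < 2 * pi)
    (alpha_quad : quadratic_irrational (tan alpha)) :
  exists Cst : R, forall N : nat, (1 < N)%N ->
    forall P3 : N.-tuple (R * R), admissible_points alpha P3 ->
    (parallelogram_discrepancy (0%R, 0%R) (0%R, 1%R) (1%R, 0%R) P3
       < (Cst * ln N%:R / N%:R)%:E)%E.
Proof.
have [K K0 KP] := closed_triangle_discrepancy alpha_quad.
(* Half-open triangles have discrepancy at most [K (1 + 3 ln N) + 1 <= (5 K + 2) ln N]. Four such
   terms come from inclusion-exclusion and a fifth from passing to the given points; the final 1
   makes the inequality strict. *)
exists (5 * (5 * K + 2) + 1) => N N1 P admP.
have N0 : 0 < N%:R :> R by rewrite ltr0n (ltn_trans _ N1).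
have [rN lnW] := box_bound R N1.
have lnN := half_le_ln R N1.
set r : R := Num.sqrt (2 * N%:R) in rN.
have r2 : r ^+ 2 = 2 * N%:R by rewrite sqr_sqrtr// mulr_ge0// ltW.
have r0 : 0 < r by rewrite sqrtr_gt0 mulr_gt0.
pose L : R := (5 * K + 2) * ln N%:R.
have HL b1 b2 b3 (c1 c2 c3 : R) : 0 <= c1 -> 0 <= c2 -> 0 <= c3 ->
    `|lattice_discrepancy alpha r N (coordinate_triangle b1 b2 b3 c1 c2 c3)| <=
      L.
  move=> c10 c20 c30.
  apply: (@le_trans _ _ (K * (1 + ln (2 * N).+1%:R) + 1)).
    by apply: half_open_triangle_discrepancy => // d1 d2 d3 *; exact: KP.
  have : K * (1 + ln (2 * N).+1%:R) <= K * (5 * ln N%:R) by rewrite ler_pM2l//;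
    lra.
  rewrite /L; lra.
have volO : fine (vol (right_triangle R)) = 2^-1.
  by rewrite right_triangleE vol_coordinate_triangle ?addr0// subr0 expr1n
    div1r.
set s := triangle_points alpha r N.
have us : uniq s by exact: uniq_triangle_points.
have sE : [set` s] = rotated_lattice_points alpha N by exact: triangle_pointsE.
(* The full triangle is among those tested, and its expected count is [2 N * 1/2 = N]. *)
have sizeN : `|(size s)%:R - N%:R| <= L.
  have := HL true true true 0 0 0 (lexx _) (lexx _) (lexx _).
  rewrite -right_triangleE /lattice_discrepancy volO r2 -size_triangle_points
    distrC.
  by rewrite mulrAC divff// mul1r.
(* In either case one of the lists [s] and [P] is duplicate-free and contained in the other, so the
   counts differ by at most the difference of the lengths. *)
have close (S : set (R * R)) : `|\sum_(p <- s) \1_S p - \sum_(p <- P) \1_S p|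
  <= L.
  have f01 (p : R * R) : 0 <= (\1_S p : R) <= 1 by rewrite indicE ler0n lern1
    leq_b1.
  apply: le_trans sizeN; rewrite -[N%:R](congr1 _ (size_tuple P)).
  case: admP; rewrite -sE (card_le_set_seq _ us) => inN outN.
  have [/inN[uP subP]|/negP/outN[_ subs]] := boolP (N <= size s)%N.
    have /andP[h0 h1] := sum_subset_seq f01 uP (subP : {subset P <= s}).
    by rewrite ger0_norm// (le_trans h1)// ler_norm.
  have /andP[h0 h1] := sum_subset_seq f01 us (subs : {subset s <= P}).
  rewrite distrC ger0_norm// (le_trans h1)// distrC ler_norm//.
apply: (@le_lt_trans _ _ ((5 * L / N%:R)%:E)); last first.
  rewrite lte_fin ltr_pM2r ?invr_gt0// /L.
  lra.
apply: ge_ereal_sup => _ [S parS <-]; rewrite lee_fin.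
have := parallelograms_discrepancy r0 HL parS.
have := close S.
rewrite sum_triangle_points /lattice_discrepancy r2 /local_discrepancy.
rewrite -/(right_triangle R) volO => h1 h2.
rewrite ler_pdivlMr// -[X in _ * X <= _](gtr0_norm N0) -normrM.
rewrite (_ : _ * N%:R = 2 * N%:R * fine (vol (S `&` right_triangle R)) -
  \sum_(p <- P) \1_S p); last first.
  by field; rewrite gt_eqF.
move: h1 h2; move: (2 * N%:R * _) (\sum_(p <- P) _) (point_count _ _ _ _);
  clear.
move=> a b c; rewrite !ler_norml => /andP[? ?] /andP[? ?].
by apply/andP; split; lra.
Qed.
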